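(* There exists a deterministic (non-oblivious local search) algorithm which, for every fixed $\varepsilon > 0$, given value oracle access to a non-negative monotone submodular function $f\colon 2^{\mathcal{N}} \to \mathbb{R}_{\geq 0}$ and independence oracle access to a matroid $\mathcal{M} = (\mathcal{N}, \mathcal{I})$ over the same ground set, outputs a set $S \in \mathcal{I}$ with $f(S) \geq (1 - 1/e - \varepsilon)\cdot \max\{f(T) : T \in \mathcal{I}\}$, using $\tilde{O}_\varepsilon(nr)$ value and independence oracle queries, where $n = |\mathcal{N}|$ and $r$ is the rank of $\mathcal{M}$. Using randomization, the query complexity can be improved to $\tilde{O}_\varepsilon(n + r\sqrt{n})$ (with the approximation guarantee $1 - 1/e - \varepsilon$ holding in expectation).
   Context: A set function $f\colon 2^{\mathcal{N}}\to\mathbb{R}$ is monotone if $f(S)\le f(T)$ whenever $S\subseteq T$, and submodular if $f(S)+f(T)\ge f(S\cap T)+f(S\cup T)$ for all $S,T\subseteq\mathcal{N}$. A matroid $\mathcal{M}=(\mathcal{N},\mathcal{I})$ is a non-empty down-closed family $\mathcal{I}$ of subsets of $\mathcal{N}$ (the independent sets) satisfying the exchange axiom; its rank is the maximum size of an independent set. A value oracle returns $f(S)$ given $S$; an independence oracle answers whether $S \in \mathcal{I}$. The query complexity counts oracle calls. The notation $\tilde{O}_\varepsilon(\cdot)$ suppresses poly-logarithmic factors and factors depending only on $\varepsilon$. *)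

(* Defs.v *)
From mathcomp Require Import all_boot all_order all_algebra.
From mathcomp Require Import reals sequences exp.

Set Implicit Arguments.
Unset Strict Implicit.
Unset Printing Implicit Defensive.

Import Order.TTheory GRing.Theory Num.Theory.
Local Open Scope ring_scope.

Section SetFunctions.
Context {R : realType} {N : finType}.
Implicit Types f : {set N} -> R.

Definition set_nonneg f : Prop := forall S, 0 <= f S.

Definition set_monotone f : Prop :=
  forall S T : {set N}, S \subset T -> f S <= f T.

Definition submodular f : Prop :=
  forall S T : {set N}, f (S :&: T) + f (S :|: T) <= f S + f T.

End SetFunctions.

Record matroid (N : finType) := Matroid {
  indep : {set {set N}};
  indep_nonempty : indep != set0;
  indep_down : forall A B : {set N},
    B \in indep -> A \subset B -> A \in indep;
  indep_exchange : forall A B : {set N},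
    A \in indep -> B \in indep -> (#|A| < #|B|)%N ->
    exists2 x, x \in B :\: A & x |: A \in indep }.

Definition rank {N : finType} (M : matroid N) : nat :=
  \max_(S in indep M) #|S|.

(* The maximum of f over the independent sets: the empty set is independent,
   so starting the iterated maximum at its value adds nothing. *)
Definition max_indep {R : realType} {N : finType}
    (f : {set N} -> R) (M : matroid N) : R :=
  \big[Num.max/f set0]_(T in indep M) f T.

(* A deterministic algorithm with oracle access, as an adaptive decision tree:
   it sees the function and the matroid only through the answers to the
   queries it makes, and only these queries are counted. *)
Inductive det_algo (R : realType) (N : finType) (T : Type) : Type :=
| Return of T
| AskValue of {set N} & (R -> det_algo R N T)
| AskIndep of {set N} & (bool -> det_algo R N T).

Arguments Return {R N T}.
Arguments AskValue {R N T}.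
Arguments AskIndep {R N T}.

Section Execution.
Context {R : realType} {N : finType} {T : Type}.
Variables (f : {set N} -> R) (M : matroid N).

Fixpoint output (a : det_algo R N T) : T :=
  match a with
  | Return t => t
  | AskValue Q k => output (k (f Q))
  | AskIndep Q k => output (k (Q \in indep M))
  end.

Fixpoint queries (a : det_algo R N T) : nat :=
  match a with
  | Return _ => 0%N
  | AskValue Q k => (queries (k (f Q))).+1
  | AskIndep Q k => (queries (k (Q \in indep M))).+1
  end.

End Execution.

(* A randomized algorithm is a finitely supported probability distribution over
   deterministic ones: the random seed is drawn independently of the input. *)
Record rand_algo (R : realType) (N : finType) (T : Type) := RandAlgo {
  seed : finType;
  seed_prob : seed -> R;
  seed_prob_ge0 : forall w, 0 <= seed_prob w;
  seed_prob_sum1 : \sum_w seed_prob w = 1;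
  run_seed : seed -> det_algo R N T }.

Definition expected_value {R : realType} {N : finType}
    (f : {set N} -> R) (M : matroid N) (a : rand_algo R N {set N}) : R :=
  \sum_(w : seed a) seed_prob w * f (output f M (run_seed w)).

(* The factor hidden by soft-O notation. The shift keeps the logarithm bounded
   away from 0 on ground sets with at most one element. *)
Definition polylog {R : realType} (k n : nat) : R := ln (n.+2%:R) ^+ k.

(* Main.v *)
(* Keep a basis S of the matroid, coloured with L = ell + 1 colours, and write
   S_J for its elements coloured in J.  The local search increases the auxiliary
   objective g = sum_J alpha_|J| f(S_J) instead of f.  The weights alpha satisfy
   (L - i) alpha_(i+1) = (1 + 1/L) i alpha_i, so that, when the swaps o <-> h o
   along an exchange bijection h from an optimal basis O to S are averaged over
   the colour given to o, all the terms f(S_J) cancel except those of the empty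
   and of the full set of colours: with Q = (1 + 1/L)^L, the linearized gains
   add up to at least L ((Q - 1) f(O) - Q f(S)).  If every step gains a constant
   fraction of 1/r of this sum, telescoping g over O_eps(r) steps shows that the
   best visited basis has value at least (1 - 1/Q - eps/2) f(O), and 1 - 1/Q
   tends to 1 - 1/e.

   After sorting the elements of S by their loss, the cheapest element that
   makes room for a new element u is found by binary search with independence
   queries, so a step that tries m elements against a part V of S costs
   O_eps(m log n + |V|) queries.  The deterministic algorithm tries all elements
   against S.  The randomized one cuts S into b = O(1 + r / sqrt n) blocks of
   size at most sqrt n and tries about n b / r random elements against a random
   block: each pair (o, h o) is then met with probability of order 1/r. *)

Require Import Defs.
From mathcomp Require Import all_boot all_order all_algebra.
From mathcomp Require Import reals sequences exp.
From mathcomp Require Import zify ring lra.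

Set Implicit Arguments.
Unset Strict Implicit.
Unset Printing Implicit Defensive.

Import Order.TTheory GRing.Theory Num.Theory.
Local Open Scope ring_scope.

(** * Matroids and submodular functions *)

Section Matroid.
Context {N : finType} (M : matroid N).
Implicit Types A B E S X : {set N}.

Definition basis S := (S \in indep M) && (#|S| == rank M).

Lemma indep_card_le A : A \in indep M -> (#|A| <= rank M)%N.
Proof. by move=> IA; rewrite /rank (bigD1 A) //= leq_maxl. Qed.

(** The exchange axiom adds elements of [B] to [A] one at a time until the sizes agree. *)
Lemma indep_extend A B :
    A \in indep M -> B \in indep M -> (#|A| <= #|B|)%N ->
  exists E, [/\ E \in indep M, A \subset E, E \subset A :|: B & #|E| = #|B|].
Proof.
move En: (#|B| - #|A|)%N => n; elim: n A En => [|n IHn] A En IA IB leAB.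
  by exists A; rewrite IA subsetUl; split=> //; lia.
have [|x /setDP[xB xNA] IxA] := indep_exchange IA IB; first lia.
have cxA : #|x |: A| = #|A|.+1 by rewrite cardsU1 xNA.
have [||||E [IE sxE sE cE]] := IHn (x |: A) => //; try lia.
have sAE : A \subset E := subset_trans (subsetUr _ _) sxE.
exists E; split=> //.
by apply: subset_trans sE _; rewrite !subUset sub1set !inE xB orbT subsetUl subsetUr.
Qed.

Lemma basis_dep S x : basis S -> x \notin S -> x |: S \notin indep M.
Proof.
move=> /andP[_ /eqP cS] xNS; apply/negP => /indep_card_le.
by rewrite cardsU1 xNS cS ltnn.
Qed.

Lemma basis_card S : basis S -> #|S| = rank M.
Proof. by case/andP=> _ /eqP. Qed.

Lemma basis_indep S : basis S -> S \in indep M.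
Proof. by case/andP. Qed.

Lemma basis_swap S u v :
    basis S -> v \in S -> u \notin S :\ v -> u |: S :\ v \in indep M ->
  basis (u |: S :\ v).
Proof.
move=> /basis_card cS vS uN ISuv; rewrite /basis ISuv cardsU1 uN -cS.
by rewrite [in X in _ == X](cardsD1 v S) vS eqxx.
Qed.

(** Extending [b |: A :\: X] by elements of [A] to size [#|A|] gives a set that contains [b], hence
    misses exactly one element of [A], and that one lies in [X]. So when removing a whole set makes
    room for [b], removing one of its elements already does. *)
Lemma indep_setU1D A b X :
    A \in indep M -> b \notin A -> b |: A \notin indep M -> X \subset A ->
    b |: A :\: X \in indep M ->
  exists2 a, a \in X & b |: A :\ a \in indep M.
Proof.
move=> IA bNA DbA sXA IbX.
have X_gt0 : (0 < #|X|)%N.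
  rewrite card_gt0; apply: contra DbA => /eqP X0.
  by move: IbX; rewrite X0 setD0.
have bND : b \notin A :\: X by rewrite inE (negPf bNA) andbF.
have cX : #|A :\: X| = (#|A| - #|X|)%N by rewrite cardsD (setIidPr sXA).
have leXA := subset_leq_card sXA.
have [|E [IE sbE sE cE]] := indep_extend IbX IA.
  by rewrite cardsU1 bND cX; lia.
have bE : b \in E by apply: (subsetP sbE); rewrite setU11.
have [a aA aNE] : exists2 a, a \in A & a \notin E.
  apply/subsetPn; apply: contra bNA => sAE.
  suff -> : A = E by [].
  by apply/eqP; rewrite eqEcard sAE cE /=.
exists a.
  apply: contraR aNE => aNX; apply: (subsetP sbE).
  by rewrite !inE aNX aA orbT.
suff <- : E = b |: A :\ a by [].
apply/eqP; rewrite eqEcard; apply/andP; split.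
  apply/subsetP=> x xE; move: (subsetP sE x xE); rewrite !inE.
  have -> /= : x != a by apply: contraNneq aNE => <-.
  by case: eqP => //= _; case: (x \in A); rewrite ?andbF.
by rewrite cE cardsU1 [in X in (_ <= X)%N](cardsD1 a A) !inE (negPf bNA) andbF aA.
Qed.

Lemma sym_exchange A B b :
    basis A -> basis B -> b \in B -> b \notin A ->
  exists a, [/\ a \in A, a \notin B, b |: A :\ a \in indep M
              & a |: B :\ b \in indep M].
Proof.
move=> bA bB bB' bNA.
have [IA IB] := (basis_indep bA, basis_indep bB).
have [cA cB] := (basis_card bA, basis_card bB).
(* [D] collects what [b] can replace in [A], so [b |: D] is the fundamental circuit of [b]. *)
pose D := [set a in A | b |: A :\ a \in indep M].
have sDA : D \subset A by apply/subsetP=> x; rewrite inE => /andP[].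
have DbD : b |: D \notin indep M.
  apply/negP => IbD.
  have AD : D = A :\: (A :\: D) by rewrite setDDr setDv set0U (setIidPr sDA).
  rewrite AD in IbD.
  have [|a] := indep_setU1D IA bNA (basis_dep bA bNA) _ IbD; first exact: subsetDl.
  by rewrite !inE => /andP[/negP aND aA] Ia; apply: aND; rewrite aA.
have IBb : B :\ b \in indep M by apply: indep_down IB _; exact: subsetDl.
have cBb : #|B :\ b| = #|B|.-1 by rewrite (cardsD1 b B) bB'.
have B_gt0 : (0 < #|B|)%N by rewrite (cardsD1 b B) bB'.
have ID : D \in indep M by apply: indep_down IA sDA.
have [/exists_inP[a aD /andP[aN Ia]]|/exists_inPn noD] := boolP
    [exists a in D, (a \notin B :\ b) && (a |: B :\ b \in indep M)].
  have aA := subsetP sDA a aD; exists a; split=> //.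
    apply: contra aN => aB; rewrite !inE aB andbT.
    by apply: contraNneq bNA => <-.
  by move: aD; rewrite inE => /andP[].
(* When no element of [D] extends [B :\ b], the latter spans [D], and no independent subset of
   [D :|: (B :\ b)] is larger. *)
have maxBb E : E \in indep M -> E \subset D :|: (B :\ b) -> (#|E| <= #|B :\ b|)%N.
  move=> IE sE; rewrite leqNgt; apply/negP => ltBE.
  have [x /setDP[xE xN] Ix] := indep_exchange IBb IE ltBE.
  have xD : x \in D by move: (subsetP sE x xE); rewrite inE (negPf xN) orbF.
  by move: (noD x xD); rewrite xN Ix.
have [|E [IE sDE sE cE]] := indep_extend ID IBb.
  by apply: maxBb => //; exact: subsetUl.
(* No [x] in [B] can extend [E]: [x = b] would make [b |: D] independent, and any other [x]
   contradicts [maxBb]. *)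
have [|x /setDP[xB xNE] Ix] := indep_exchange IE IB; first by rewrite cE cBb prednK.
have [xb|xNb] := eqVneq x b.
  case/negP: DbD; apply: indep_down Ix _.
  by rewrite xb setUS.
suff : (#|x |: E| <= #|B :\ b|)%N by rewrite cardsU1 xNE cE ltnn.
by apply: maxBb Ix _; rewrite subUset sE sub1set !inE xNb xB orbT.
Qed.

(* Iterating the symmetric exchange moves [O] towards [S] one element at a
   time; elements of [O :&: S] are necessarily matched to themselves. *)
Lemma basis_matching S O :
    basis S -> basis O ->
  exists h : N -> N,
    {in O &, injective h} /\
    forall o, o \in O ->
      [/\ h o \in S, o \notin S :\ h o & o |: S :\ h o \in indep M].
Proof.
move=> bS; move En: #|O :\: S| => n; elim: n O En => [|n IHn] O En bO.
  have sOS : O \subset S by rewrite -setD_eq0 -cards_eq0 En.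
  exists id; split=> // o /(subsetP sOS) oS; split=> //.
    by rewrite !inE eqxx.
  by rewrite setD1K // basis_indep.
have /card_gt0P[b /setDP[bO' bNS]] : (0 < #|O :\: S|)%N by rewrite En.
have [a [aS aNO Ib Ia]] := sym_exchange bS bO bO' bNS.
have aNOb : a \notin O :\ b by rewrite !inE (negPf aNO) andbF.
have bO2 := basis_swap bO bO' aNOb Ia.
have [|h [hinj hP]] := IHn (a |: O :\ b) _ bO2.
  have -> : (a |: O :\ b) :\: S = (O :\: S) :\ b.
    apply/setP=> x; rewrite !inE; case: (eqVneq x a) => [->|_] /=.
      by rewrite aS andbF.
    by rewrite andbCA.
  by move: En; rewrite (cardsD1 b (O :\: S)) !inE bNS bO' /= => -[].
(* Since [a] lies in [S], the condition [a \notin S :\ h a] leaves no other choice; [b], which [a]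
   replaced in the basis, can then inherit the image [a]. *)
have haa : h a = a.
  have [_ + _] := hP a (setU11 _ _).
  by rewrite !inE aS andbT negbK => /eqP.
have inO' o : o \in O -> o != b -> o \in a |: O :\ b.
  by move=> oO oNb; rewrite !inE oNb oO orbT.
have hNa o : o \in O -> o != b -> h o != a.
  move=> oO oNb; rewrite -haa; apply/eqP=> /(hinj _ _ (inO' _ oO oNb) (setU11 _ _)) oa.
  by move: aNO; rewrite -oa oO.
exists (fun o => if o == b then a else h o); split=> [o1 o2 o1O o2O|o oO].
  case: eqVneq => [->|n1]; case: eqVneq => [->|n2] //.
  - by move=> /esym /eqP; rewrite (negPf (hNa _ o2O n2)).
  - by move=> /eqP; rewrite (negPf (hNa _ o1O n1)).
  - by apply: hinj; apply: inO'.
case: eqVneq => [->|oNb]; first by split=> //; rewrite !inE (negPf bNS) andbF.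
exact/hP/inO'.
Qed.

End Matroid.

(** * Sums of marginal values *)

Section Submodular.
Context {R : realType} {N : finType} (f : {set N} -> R).
Hypotheses (fm : set_monotone f) (fs : submodular f).
Implicit Types P X : {set N}.

(** When the elements of [X] are added one by one, diminishing returns bound each gain by the one
    measured at [P]. *)
Lemma submodular_addition X P :
  f (X :|: P) - f P <= \sum_(x in X) (f (x |: P) - f P).
Proof.
rewrite -[X in X :|: P](set_enum X) -big_enum /=.
elim: (enum X) => [|a s IHs].
  by rewrite set_nil set0U subrr big_nil.
rewrite big_cons set_cons.
have := fs (a |: P) ([set x in s] :|: P).
have : f P <= f ((a |: P) :&: ([set x in s] :|: P)).
  by apply: fm; rewrite subsetI !subsetUr.
have -> : (a |: P) :|: ([set x in s] :|: P) = (a |: [set x in s]) :|: P.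
  by apply/setP=> x; rewrite !inE; case: (x == a); case: (x \in P); rewrite ?orbT ?orbF.
lra.
Qed.

(** When the elements are removed one by one, each loss is at least the one measured at the full set
    [P]. *)
Lemma submodular_deletion X P :
  \sum_(x in X) (f P - f (P :\ x)) <= f P - f (P :\: X).
Proof.
rewrite -[X in P :\: X](set_enum X) -big_enum /=.
elim: (enum X) (enum_uniq X) => [|a s IHs] /=.
  by rewrite set_nil setD0 subrr big_nil.
move=> /andP[aNs us]; rewrite big_cons set_cons.
have := IHs us.
have := fs (P :\ a) (P :\: [set x in s]).
have -> : (P :\ a) :|: (P :\: [set x in s]) = P.
  apply/setP=> x; rewrite !inE; case: (eqVneq x a) => [->|] //=; rewrite ?aNs //.
  by case: (x \in P); rewrite ?andbF ?orbF.
have -> : (P :\ a) :&: (P :\: [set x in s]) = P :\: (a |: [set x in s]).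
  apply/setP=> x; rewrite !inE negb_or.
  by case: (x == a); case: (x \in P); case: (x \in s).
lra.
Qed.

End Submodular.

(** * The non-oblivious objective *)

Section Alpha.
Context {R : realType} (ell : nat).

Definition growth : R := 1 + ell.+1%:R^-1.

(** Closed form of the recurrence [alphaS] started from [alpha 1 = 1]. The recurrence fails at 0,
    because [alpha 0 = 0]; this is why a term for the empty set of colours survives in
    [total_swap_gain]. *)
Definition alpha (i : nat) : R :=
  if i is i'.+1 then growth ^+ i' / 'C(ell, i')%:R else 0.

Lemma growth_ge1 : 1 <= growth.
Proof. by rewrite lerDl invr_ge0 ler0n. Qed.

Lemma alpha_ge0 i : 0 <= alpha i.
Proof.
case: i => [//|i]; rewrite divr_ge0 ?ler0n // exprn_ge0 //.
exact: le_trans growth_ge1.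
Qed.

Lemma alpha1 : alpha 1 = 1.
Proof. by rewrite /alpha expr0 bin0 divr1. Qed.

Lemma alpha_last : alpha ell.+1 = growth ^+ ell.
Proof. by rewrite /alpha binn divr1. Qed.

Lemma alphaS i : (0 < i <= ell)%N ->
  (ell.+1 - i)%:R * alpha i.+1 = growth * i%:R * alpha i.
Proof.
case: i => [//|i] /andP[_ lti]; rewrite /alpha exprS subSS.
have bin_neq0 m : (m <= ell)%N -> 'C(ell, m)%:R != 0 :> R.
  by move=> lem; rewrite pnatr_eq0 -lt0n bin_gt0.
have := congr1 (fun k => k%:R : R) (mul_bin_left ell i).
rewrite !natrM => binE.
have -> : i.+1%:R = (ell - i)%:R * 'C(ell, i)%:R / 'C(ell, i.+1)%:R :> R.
  by rewrite -binE mulfK // bin_neq0.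
by field; rewrite !bin_neq0 // ltnW.
Qed.

End Alpha.

Arguments alpha : simpl never.

Section Potential.
Context {R : realType} {N : finType} {ell : nat}.
Notation L := ell.+1.
Notation alpha := (@alpha R ell).
Notation growth := (@growth R ell).

Record state := State { base : {set N}; colour : N -> 'I_L }.
Implicit Types (st : state) (J : {set 'I_L}) (u v o : N) (j k : 'I_L).

Definition part st J := [set x in base st | colour st x \in J].

(** For [u] in the base the choice [v = u] is meaningful: it only recolours [u]. *)
Definition swap st u j v :=
  State (u |: base st :\ v) (fun x => if x == u then j else colour st x).

Lemma part_sub st J : part st J \subset base st.
Proof. by apply/subsetP=> x; rewrite inE => /andP[]. Qed.

Lemma partT st : part st setT = base st.
Proof. by apply/setP=> x; rewrite !inE andbT. Qed.

Lemma part_swap st u j v J :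
    v \in base st -> u \notin base st :\ v ->
  part (swap st u j v) J =
    if j \in J then u |: part st J :\ v else part st J :\ v.
Proof.
rewrite !inE => vS uN; apply/setP=> x.
rewrite (fun_if (fun A : {set N} => x \in A)) !inE /=.
case: (eqVneq x u) => [->|xu] /=.
  by case: (j \in J); rewrite ?andbT ?andbF //= andbA (negPf uN).
by rewrite andbA; case: ifP.
Qed.

Section Objective.
Variable f : {set N} -> R.

Definition potential st := \sum_(J : {set 'I_L}) alpha #|J| * f (part st J).

(** The gain is measured without removing anything, so it is independent of the element that leaves,
    just as [del_loss] is independent of the one that enters. *)
Definition add_gain st u j :=
  \sum_(J : {set 'I_L} | j \in J) alpha #|J| * (f (u |: part st J) - f (part st J)).

Definition del_loss st v :=
  \sum_(J : {set 'I_L}) alpha #|J| * (f (part st J) - f (part st J :\ v)).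

Hypotheses (f0 : set_nonneg f) (fm : set_monotone f) (fs : submodular f).

(** Submodularity is applied to [u |: P :\ v] and [P]: their union contains [u |: P] and their
    intersection contains [P :\ v]. *)
Lemma potential_swap st u j v :
    v \in base st -> u \notin base st :\ v ->
  potential st + (add_gain st u j - del_loss st v) <= potential (swap st u j v).
Proof.
move=> vS uN; rewrite /add_gain big_mkcond /= -sumrB -big_split /=.
apply: ler_sum => J _; rewrite part_swap //.
set P := part st J; case: ifP => _; last by rewrite sub0r mulrBr opprB addrC subrK.
rewrite -mulrBr -mulrDr ler_wpM2l ?alpha_ge0 //.
have := fs (u |: P :\ v) P.
have : f (P :\ v) <= f ((u |: P :\ v) :&: P).
  by apply: fm; rewrite subsetI subsetUr subsetDl.
have : f (u |: P) <= f ((u |: P :\ v) :|: P).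
  by apply: fm; rewrite -setUA setUS // subsetUr.
lra.
Qed.

(** The elements are grouped by colour [k]. For [k] in [J] the single losses add up to at most the
    loss of the whole colour class; the other classes do not meet [part st J]. *)
Lemma del_loss_sum st :
  \sum_(v in base st) del_loss st v <=
  \sum_(J : {set 'I_L}) \sum_(k in J) alpha #|J| * (f (part st J) - f (part st (J :\ k))).
Proof.
rewrite exchange_big /=; apply: ler_sum => J _.
rewrite -!mulr_sumr ler_wpM2l ?alpha_ge0 //.
rewrite (partition_big (colour st) predT) //= [leRHS]big_mkcond /=.
apply: ler_sum => k _; case: ifP => kJ.
  have -> : part st (J :\ k) = part st J :\: part st [set k].
    apply/setP=> x; rewrite !inE; case: (x \in base st) => //=.
  rewrite (eq_bigl (fun v => v \in part st [set k])); last first.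
    by move=> x; rewrite !inE.
  exact: submodular_deletion.
rewrite big1 // => v /andP[vS /eqP vk].
suff /setDidPl -> : [disjoint part st J & [set v]] by rewrite subrr.
by rewrite disjoint_sym disjoints1 inE vk kJ andbF.
Qed.

(* Both sides sum [alpha #|J'| * phi J] over the pairs [J' = k |: J] with [k \notin J]. *)
Lemma sum_del1 (phi : {set 'I_L} -> R) :
  \sum_(J : {set 'I_L}) \sum_(k in J) alpha #|J| * phi (J :\ k) =
  \sum_(J : {set 'I_L}) (L - #|J|)%:R * alpha #|J|.+1 * phi J.
Proof.
rewrite (exchange_big_dep predT) //=.
transitivity (\sum_k \sum_(J : {set 'I_L} | k \notin J) alpha #|J|.+1 * phi J).
  apply: eq_bigr => k _.
  rewrite (reindex_onto (fun J => k |: J) (fun J => J :\ k)) /=; last first.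
    by move=> J kJ; rewrite setD1K.
  rewrite (eq_bigl (fun J : {set 'I_L} => k \notin J)) => [|J]; last first.
    rewrite setU11 /=; apply/eqP/idP => [<-|kJ]; first by rewrite !inE eqxx.
    by rewrite setU1K.
  by apply: eq_bigr => J kJ; rewrite cardsU1 kJ setU1K.
rewrite (exchange_big_dep predT) //=; apply: eq_bigr => J _.
have cJ : #|[pred k | k \notin J]| = (L - #|J|)%N.
  have := cardC J; rewrite card_ord => cJ.
  apply/eqP; rewrite -(eqn_add2l #|J|) subnKC; first exact/eqP.
  by rewrite -[leqRHS]cJ leq_addr.
by rewrite sumr_const cJ -[RHS]mulrA [RHS]mulr_natl.
Qed.

(** Each [J] is met once for each colour [j] in it, whence the factor [#|J|]; by monotonicity,
    adding [O] to a part reaches at least [f O]. *)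
Lemma add_gain_sum st (O : {set N}) :
  \sum_(J : {set 'I_L}) #|J|%:R * alpha #|J| * (f O - f (part st J)) <=
  \sum_(o in O) \sum_j add_gain st o j.
Proof.
rewrite /add_gain.
under [leRHS]eq_bigr => o _ do rewrite (exchange_big_dep predT) //=.
rewrite exchange_big /=; apply: ler_sum => J _.
under eq_bigr => o _ do rewrite sumr_const -mulr_natl mulrA.
rewrite -mulr_sumr ler_wpM2l ?mulr_ge0 ?ler0n ?alpha_ge0 //.
apply: le_trans (submodular_addition fm fs _ _).
by rewrite lerD2r; apply: fm; exact: subsetUl.
Qed.

(* With [phi J = f O - f (part st J)] the bounds on additions and deletions
   combine into a weighted sum of the [phi J] in which [alphaS] cancels every
   term except those of the empty and of the full set of colours. *)
Lemma total_swap_gain st (O : {set N}) (h : N -> N) :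
    {in O &, injective h} -> h @: O = base st ->
  L%:R * ((growth ^+ L - 1) * f O - growth ^+ L * f (base st)) <=
  \sum_(o in O) (L%:R^-1 * \sum_j add_gain st o j - del_loss st (h o)).
Proof.
move=> hinj hO; pose phi J := f O - f (part st J).
have L_gt0 : 0 < L%:R :> R by rewrite ltr0n.
have L_inv : 0 <= L%:R^-1 :> R by rewrite invr_ge0 ler0n.
rewrite sumrB -mulr_sumr -(big_imset (del_loss st) hinj) /= hO.
have add := ler_wpM2l L_inv (add_gain_sum st O).
have del := del_loss_sum st.
apply: le_trans (lerB add del).
(* Each difference is [phi (J :\ k) - phi J]; [sum_del1] reindexes the first half. *)
have -> : \sum_(J : {set 'I_L}) \sum_(k in J)
      alpha #|J| * (f (part st J) - f (part st (J :\ k)))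
    = \sum_(J : {set 'I_L}) (L - #|J|)%:R * alpha #|J|.+1 * phi J
      - \sum_(J : {set 'I_L}) #|J|%:R * alpha #|J| * phi J.
  rewrite -sum_del1 -sumrB; apply: eq_bigr => J _.
  rewrite -mulrA mulr_natl -sumr_const -sumrB; apply: eq_bigr => k _.
  by rewrite -mulrBr /phi; congr (_ * _); ring.
rewrite opprB mulr_sumr addrA -big_split /= -sumrB.
(* In [growth], the 1 comes from the deletions and the [1 / L] from the additions averaged over the
   colours. *)
pose c i := growth * i%:R * alpha i - (L - i)%:R * alpha i.+1.
rewrite (eq_bigr (fun J => c #|J| * phi J)) => [|J _]; last first.
  by rewrite /c /growth /phi; ring.
have neT0 : setT != set0 :> {set 'I_L} by rewrite -card_gt0 cardsT card_ord.
(* The full set has coefficient [L * growth ^+ L] and the empty set [- L]; the remaining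
   [f (part st set0)] is non-negative and is dropped. *)
rewrite (bigD1 setT) //= (bigD1 set0) 1?eq_sym //= big1 => [|J /andP[JT J0]].
  rewrite /c cardsT card_ord cards0 subnn subn0 alpha1 alpha_last /phi partT.
  have := mulr_ge0 (ltW L_gt0) (f0 (part st set0)); rewrite exprS; lra.
rewrite /c alphaS ?subrr ?mul0r // card_gt0 J0 -ltnS -[X in (_ < X)%N]card_ord -cardsT.
by apply: proper_card; rewrite properT.
Qed.

End Objective.
End Potential.

(** * Local search with oracle queries *)

Section Monad.
Context {R : realType} {N : finType}.
Notation algo := (det_algo R N).

Fixpoint bind A B (a : algo A) (h : A -> algo B) : algo B :=
  match a with
  | Return x => h x
  | AskValue Q k => AskValue Q (fun y => bind (k y) h)
  | AskIndep Q k => AskIndep Q (fun y => bind (k y) h)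
  end.

Fixpoint mapA A B (F : A -> algo B) (s : seq A) : algo (seq B) :=
  if s is x :: s' then
    bind (F x) (fun y => bind (mapA F s') (fun ys => Return (y :: ys)))
  else Return [::].

Definition lin_query (s : seq (R * {set N})) : algo R :=
  bind (mapA (fun p => AskValue p.2 (fun y => Return (p.1 * y))) s)
    (fun ys => Return (\sum_(y <- ys) y)).

Fixpoint greedy (S : {set N}) (s : seq N) : algo {set N} :=
  if s is x :: s' then
    AskIndep (x |: S) (fun b => greedy (if b then x |: S else S) s')
  else Return S.

Fixpoint bsearch (Q : nat -> {set N}) (k lo : nat) : algo nat :=
  if k is k'.+1 then
    AskIndep (Q (lo + 2 ^ k')%N)
      (fun b => bsearch Q k' (if b then lo else (lo + 2 ^ k')%N))
  else Return lo.

Variables (f : {set N} -> R) (M : matroid N).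
Local Notation out := (output f M).
Local Notation cost := (queries f M).

Lemma output_bind A B (a : algo A) (h : A -> algo B) :
  out (bind a h) = out (h (out a)).
Proof. by elim: a => //= Q k IH; rewrite IH. Qed.

Lemma queries_bind A B (a : algo A) (h : A -> algo B) :
  cost (bind a h) = (cost a + cost (h (out a)))%N.
Proof. by elim: a => //= Q k IH; rewrite IH addSn. Qed.

Lemma output_mapA A B (F : A -> algo B) s :
  out (mapA F s) = [seq out (F x) | x <- s].
Proof. by elim: s => //= x s IHs; rewrite !output_bind /= IHs. Qed.

Lemma queries_mapA A B (F : A -> algo B) s c :
  (forall x, (cost (F x) <= c)%N) -> (cost (mapA F s) <= size s * c)%N.
Proof.
move=> Fc; elim: s => //= x s IHs.
by rewrite !queries_bind /= addn0 mulSn leq_add.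
Qed.

Lemma output_lin_query s : out (lin_query s) = \sum_(p <- s) p.1 * f p.2.
Proof. by rewrite /lin_query output_bind output_mapA /= big_map. Qed.

Lemma queries_lin_query s : (cost (lin_query s) <= size s)%N.
Proof.
by rewrite /lin_query queries_bind addn0 -[leqRHS]muln1 queries_mapA.
Qed.

Lemma queries_greedy S s : cost (greedy S s) = size s.
Proof. by elim: s S => //= x s IHs S; rewrite IHs. Qed.

(** By down-closure, an element rejected at some moment cannot be added later either. *)
Lemma greedyP S s : S \in indep M ->
  [/\ out (greedy S s) \in indep M, S \subset out (greedy S s) &
      forall x, x \in s -> x \notin out (greedy S s) ->
        x |: out (greedy S s) \notin indep M].
Proof.
elim: s S => [|x s IHs] S IS /=; first by split.
set S' := if _ then _ else _.
have IS' : S' \in indep M by rewrite /S'; case: ifP.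
have sSS' : S \subset S' by rewrite /S'; case: ifP => // _; rewrite subsetUr.
have [IT sS'T Tmax] := IHs S' IS'; split=> //; first exact: subset_trans sS'T.
move=> y; rewrite inE => /orP[/eqP -> | /Tmax //]; apply: contraNN => IxT.
apply: (subsetP sS'T); rewrite /S'.
have -> : x |: S \in indep M.
  by apply: indep_down IxT _; rewrite setUS // (subset_trans sSS').
exact: setU11.
Qed.

Lemma greedy_basis : basis M (out (greedy set0 (enum N))).
Proof.
have I0 : set0 \in indep M.
  have /set0Pn[A IA] := indep_nonempty M.
  by apply: indep_down IA _; exact: sub0set.
have [IT _ Tmax] := greedyP (enum N) I0; rewrite /basis IT eqn_leq /=.
rewrite indep_card_le //=; apply/bigmax_leqP => A IA; rewrite leqNgt.
apply/negP => /(indep_exchange IT IA)[x /setDP[_ xNT]].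
by apply/negP/Tmax; rewrite // mem_enum.
Qed.

Lemma queries_bsearch Q k lo : cost (bsearch Q k lo) = k.
Proof. by elim: k lo => //= k IHk lo; rewrite IHk. Qed.

(** Each query halves the interval, keeping its lower end dependent and its upper end
    independent. *)
Lemma bsearchP Q k lo :
    Q lo \notin indep M -> Q (lo + 2 ^ k)%N \in indep M ->
  Q (out (bsearch Q k lo)) \notin indep M /\
  Q (out (bsearch Q k lo)).+1 \in indep M.
Proof.
elim: k lo => [|k IHk] lo /= Qlo; first by rewrite expn0 addn1.
rewrite expnS mul2n -addnn addnA => Qhi.
by case: ifPn => Qmid; apply: IHk.
Qed.

End Monad.

Arguments lin_query : simpl never.

(** * The local search: correctness of a step and query counts *)

Section LocalSearch.
Context {R : realType} {N : finType} {ell : nat}.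
Notation L := ell.+1.
Notation algo := (det_algo R N).
Notation state := (@state N ell).
Notation alpha := (@alpha R ell).
Implicit Types (st : state) (u v : N) (j : 'I_L).

(** Colour sets without [j] stay in the list with coefficient 0, so that its length depends on [ell]
    only. *)
Definition add_terms st u j : seq (R * {set N}) :=
  [seq (if j \in J then alpha #|J| else 0, u |: part st J) | J : {set 'I_L}] ++
  [seq (if j \in J then - alpha #|J| else 0, part st J) | J : {set 'I_L}].

Definition del_terms st v : seq (R * {set N}) :=
  [seq (alpha #|J|, part st J) | J : {set 'I_L}] ++
  [seq (- alpha #|J|, part st J :\ v) | J : {set 'I_L}].

Definition eval_swap st u j v : algo (R * state) :=
  bind (lin_query (add_terms st u j)) (fun a =>
  bind (lin_query (del_terms st v)) (fun b =>
  Return (a - b, swap st u j v))).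

(* [vs] lists the removable elements by increasing loss, so the binary search
   finds the cheapest one that makes room for [u]; [2 ^ k] should be at least
   [size vs]. *)
Definition best_swap k st (vs : seq N) u j : algo (R * state) :=
  if u \in base st then
    if u \in vs then eval_swap st u j u else Return (0, st)
  else
    let Q i := u |: base st :\: [set x in take i vs] in
    AskIndep (Q (2 ^ k)%N) (fun b =>
      if b then bind (bsearch Q k 0) (fun i => eval_swap st u j (nth u vs i))
      else Return (0, st)).

(** The initial candidate [(0, st)] stands for staying, so that a step never lowers the
    potential. *)
Definition best_candidate st (cs : seq (R * state)) :=
  foldr (fun c b => if b.1 <= c.1 then c else b) (0, st) cs.

Definition step k (U : seq N) (V : {set N}) st : algo state :=
  bind (mapA (fun v => bind (lin_query (del_terms st v))
                         (fun w => Return (w, v))) (enum V)) (fun ws =>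
  let vs := [seq p.2 | p <- sort (fun p q => p.1 <= q.1) ws] in
  bind (mapA (fun p => best_swap k st vs p.1 p.2)
          [seq (u, j) | u <- U, j <- enum 'I_L]) (fun cs =>
  Return (best_candidate st cs).2)).

(** From a seed and the current base, [sel] chooses the elements to insert and the part of the base
    that they may replace. The result is the visited basis best for [f], not for the potential. *)
Fixpoint search {W : Type} k (sel : W -> {set N} -> seq N * {set N})
    (ws : seq W) st : algo {set N} :=
  if ws is w :: ws' then
    bind (step k (sel w (base st)).1 (sel w (base st)).2 st) (fun st' =>
    bind (search k sel ws' st') (fun T =>
    AskValue (base st) (fun a => AskValue T (fun b =>
    Return (if b <= a then base st else T)))))
  else Return (base st).

Definition start (S : {set N}) : state := State S (fun=> ord0).

(** The rank is not known in advance: the greedy basis reveals it, and seeds beyond [K] times the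
    rank are discarded. *)
Definition local_search {W : Type} k K
    (sel : W -> {set N} -> seq N * {set N}) (ws : seq W) : algo {set N} :=
  bind (greedy set0 (enum N)) (fun S =>
  search k sel (take (K * #|S|) ws) (start S)).

Arguments eval_swap : simpl never.
Arguments best_swap : simpl never.
Arguments step : simpl never.

Variables (f : {set N} -> R) (M : matroid N).
Hypotheses (f0 : set_nonneg f) (fm : set_monotone f) (fs : submodular f).
Local Notation out := (output f M).
Local Notation cost := (queries f M).

Lemma output_add_terms st u j :
  out (lin_query (add_terms st u j)) = add_gain f st u j.
Proof.
rewrite output_lin_query /add_terms big_cat !big_image /= -big_split /=.
rewrite /add_gain [RHS]big_mkcond; apply: eq_bigr => J _ /=.
by case: ifP; rewrite ?mul0r ?addr0 // mulNr -mulrBr.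
Qed.

Lemma output_del_terms st v : out (lin_query (del_terms st v)) = del_loss f st v.
Proof.
rewrite output_lin_query /del_terms big_cat !big_image /= -big_split /=.
by apply: eq_bigr => J _ /=; rewrite mulNr -mulrBr.
Qed.

Lemma output_eval_swap st u j v :
  out (eval_swap st u j v) = (add_gain f st u j - del_loss f st v, swap st u j v).
Proof. by rewrite /eval_swap output_bind output_add_terms output_bind output_del_terms. Qed.

Definition sound st (c : R * state) :=
  basis M (base c.2) /\ potential f st + c.1 <= potential f c.2.

Lemma stay_sound st : basis M (base st) -> sound st (0, st).
Proof. by move=> bS; split; rewrite ?addr0. Qed.

Lemma eval_swap_sound st u j v :
    basis M (base st) -> v \in base st -> u \notin base st :\ v ->
    u |: base st :\ v \in indep M ->
  sound st (out (eval_swap st u j v)).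
Proof.
move=> bS vS uN Iuv; rewrite output_eval_swap; split; first exact: basis_swap.
exact: potential_swap.
Qed.

(** By [indep_setU1D], for [u] outside the base, a prefix of [vs] makes room for [u] exactly when
    one of its elements does. At the threshold [i] found by the search, the element of index [i] is
    therefore the first one that makes room, and the sorting makes it the cheapest. *)
Lemma best_swapP k st (vs : seq N) u j :
    basis M (base st) -> {subset vs <= base st} ->
    sorted (relpre (del_loss f st) <=%R) vs -> (size vs <= 2 ^ k)%N ->
  sound st (out (best_swap k st vs u j)) /\
  forall v, v \in vs -> u \notin base st :\ v -> u |: base st :\ v \in indep M ->
    add_gain f st u j - del_loss f st v <= (out (best_swap k st vs u j)).1.
Proof.
move=> bS sub_vs srt size_vs; have IS := basis_indep bS.
rewrite /best_swap; case: ifPn => uS.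
  have eq_u v : u \notin base st :\ v -> v = u.
    by rewrite !inE uS andbT negbK => /eqP.
  case: ifPn => uvs.
    split; last by move=> v _ /eq_u -> _; rewrite output_eval_swap.
    by apply: eval_swap_sound; rewrite ?setD1K // !inE eqxx.
  split; first exact: stay_sound.
  by move=> v vvs /eq_u vu; rewrite -vu vvs in uvs.
set Q := fun i : nat => _.
have QD i v : v \in take i vs -> u |: base st :\ v \in indep M -> Q i \in indep M.
  move=> vi Iuv; apply: indep_down Iuv _; rewrite setUS //.
  by apply: setDS; rewrite sub1set inE.
have sub_take i : [set x in take i vs] \subset base st.
  by apply/subsetP=> x; rewrite inE => /mem_take /sub_vs.
have uD := basis_dep bS uS.
rewrite /=; case: ifPn => Qk; last first.
  split; first exact: stay_sound.
  move=> v vvs _ Iuv; case/negP: Qk; apply: QD Iuv.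
  by rewrite take_oversize.
rewrite output_bind.
have Q0 : Q 0%N \notin indep M.
  by rewrite /Q take0 set_nil setD0.
have [] := bsearchP f Q0 Qk.
set i := out (bsearch Q k 0) => Qi Qi1.
have lti : (i < size vs)%N.
  rewrite ltnNge; apply: contraNN Qi => gei.
  by move: Qi1; rewrite /Q !take_oversize // leqW.
have [a] := indep_setU1D IS uS uD (sub_take i.+1) Qi1.
rewrite inE (take_nth u lti) mem_rcons inE => /orP[/eqP -> Ia|ai Ia]; last first.
  by case/negP: Qi; apply: QD ai Ia.
have viS : nth u vs i \in base st by apply/sub_vs/mem_nth.
split; first by apply: eval_swap_sound; rewrite // !inE (negPf uS) andbF.
move=> v vvs _ Iuv; rewrite output_eval_swap /= lerD2l lerN2.
have ltv : (index v vs < size vs)%N by rewrite index_mem.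
have levi : (i <= index v vs)%N.
  rewrite leqNgt; apply: contraNN Qi => ltvi; apply: QD Iuv.
  by rewrite -(nth_index u vvs) -(nth_take u ltvi) mem_nth // size_takel // ltnW.
rewrite -[v in leRHS](nth_index u vvs).
apply: (sorted_leq_nth (leT := relpre (del_loss f st) <=%R)) => //.
- by move=> x y z /=; apply: le_trans.
- by move=> x /=.
Qed.

Lemma best_candidateP (T : eqType) (F : T -> R * state) s st :
    basis M (base st) -> (forall x, sound st (F x)) ->
  [/\ sound st (best_candidate st (map F s)),
      0 <= (best_candidate st (map F s)).1 &
      {in s, forall x, (F x).1 <= (best_candidate st (map F s)).1}].
Proof.
move=> bS soundF; elim: s => [|x s [IHs IH0 IHx]] /=.
  by split=> //; exact: stay_sound.
case: ifPn => [le_x|]; last rewrite -ltNge => /ltW le_x.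
  split=> //; first exact: le_trans le_x.
  move=> y; rewrite inE => /orP[/eqP -> //|/IHx yb].
  exact: le_trans yb le_x.
by split=> // y; rewrite inE => /orP[/eqP -> //|/IHx].
Qed.

Lemma stepP k (U : seq N) (V : {set N}) st (st' := out (step k U V st)) :
    basis M (base st) -> V \subset base st -> (#|V| <= 2 ^ k)%N ->
  [/\ basis M (base st'), potential f st <= potential f st' &
      forall u v j, u \in U -> v \in V ->
        u \notin base st :\ v -> u |: base st :\ v \in indep M ->
        potential f st + (add_gain f st u j - del_loss f st v) <= potential f st'].
Proof.
move=> bS /subsetP sVS size_V; rewrite /st' /step output_bind output_mapA.
set ws := [seq _ | _ <- enum V].
have {ws}-> : ws = [seq (del_loss f st v, v) | v <- enum V].
  by apply: eq_map => v; rewrite output_bind output_del_terms.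
rewrite sort_map -map_comp /= map_id output_bind output_mapA /=.
set vs := sort _ _.
have mem_vs : vs =i V by move=> v; rewrite mem_sort mem_enum.
have srt : sorted (relpre (del_loss f st) <=%R) vs.
  by apply: sort_sorted => x y; exact: le_total.
have size_vs : (size vs <= 2 ^ k)%N by rewrite size_sort -cardE.
have sub_vs : {subset vs <= base st} by move=> v; rewrite mem_vs => /sVS.
have best p := best_swapP p.1 p.2 bS sub_vs srt size_vs.
have [] := best_candidateP [seq (u, j) | u <- U, j <- enum 'I_L] bS
  (fun p => (best p).1).
set c := best_candidate _ _ => -[bS' pot] c_ge0 c_max; split=> //.
  by apply: le_trans pot; rewrite lerDl.
move=> u v j uU vV uN Iuv; apply: le_trans pot; rewrite lerD2l.
apply: le_trans (c_max (u, j) _); last by rewrite allpairs_f ?mem_enum.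
by apply: (best (u, j)).2; rewrite ?mem_vs.
Qed.

Definition eval_cost : nat := (#|{set 'I_L}| + #|{set 'I_L}|)%N.
(** Up to the factor [k.+1], this bounds the queries spent per tried or removable element; it
    depends on [ell] only and ends up in the constant. *)
Definition step_cost : nat := (L * (eval_cost + eval_cost).+1)%N.

Lemma queries_add_terms st u j : (cost (lin_query (add_terms st u j)) <= eval_cost)%N.
Proof.
by apply: leq_trans (queries_lin_query f M _) _; rewrite size_cat !size_image.
Qed.

Lemma queries_del_terms st v : (cost (lin_query (del_terms st v)) <= eval_cost)%N.
Proof.
by apply: leq_trans (queries_lin_query f M _) _; rewrite size_cat !size_image.
Qed.

Lemma queries_eval_swap st u j v :
  (cost (eval_swap st u j v) <= eval_cost + eval_cost)%N.
Proof.
rewrite /eval_swap (queries_bind _ _ (lin_query _)) (queries_bind _ _ (lin_query _)).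
by rewrite addn0 leq_add ?queries_add_terms ?queries_del_terms.
Qed.

Lemma queries_best_swap k st (vs : seq N) u j :
  (cost (best_swap k st vs u j) <= (eval_cost + eval_cost).+1 * k.+1)%N.
Proof.
have eval_le v := queries_eval_swap st u j v.
rewrite /best_swap; case: ifP => _ /=.
  by case: ifP => _ //=; apply: leq_trans (eval_le _) _; nia.
case: ifP => _ /=; last by nia.
rewrite queries_bind queries_bsearch.
move: (nth _ _ _) => v; have := eval_le v; rewrite mulnS mulSn.
by move: (_ * k)%N; lia.
Qed.

Lemma queries_step k (U : seq N) (V : {set N}) st :
  (cost (step k U V st) <= (size U + #|V|) * step_cost * k.+1)%N.
Proof.
rewrite /step queries_bind queries_bind addn0 addnC !mulnDl.
set vs := [seq _.2 | _ <- _].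
have cost_swap (p : N * 'I_L) := queries_best_swap k st vs p.1 p.2.
have cost_del v : (cost (bind (lin_query (del_terms st v)) (fun w => Return (w, v)))
    <= eval_cost)%N.
  by rewrite queries_bind addn0 queries_del_terms.
apply: leq_add.
  apply: leq_trans (queries_mapA _ cost_swap) _.
  by rewrite size_allpairs size_enum_ord /step_cost !mulnA.
apply: leq_trans (queries_mapA _ cost_del) _.
rewrite -cardE -mulnA leq_mul2l; apply/orP; right.
by rewrite /step_cost; nia.
Qed.

Section Search.
Context {W : Type} (k B : nat) (sel : W -> {set N} -> seq N * {set N}).
Hypothesis sel_sub : forall w S, basis M S -> (sel w S).2 \subset S.
Hypothesis sel_exp : forall w S, basis M S -> (#|(sel w S).2| <= 2 ^ k)%N.
Hypothesis sel_size : forall w S, basis M S ->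
  (size (sel w S).1 + #|(sel w S).2| <= B)%N.

Lemma step_basis w st : basis M (base st) ->
  basis M (base (out (step k (sel w (base st)).1 (sel w (base st)).2 st))).
Proof.
by move=> bS; have [] := stepP (sel w (base st)).1 bS (sel_sub w bS) (sel_exp w bS).
Qed.

Lemma search_basis ws st : basis M (base st) -> basis M (out (search k sel ws st)).
Proof.
elim: ws st => //= w ws IHws st bS; rewrite output_bind output_bind /=.
by case: ifP => // _; exact: IHws (step_basis _ bS).
Qed.

Lemma search_value w ws st :
  f (out (search k sel (w :: ws) st)) =
  Num.max (f (base st))
    (f (out (search k sel ws
       (out (step k (sel w (base st)).1 (sel w (base st)).2 st))))).
Proof.
rewrite /= output_bind output_bind /= (fun_if f).
by case: leP.
Qed.

Lemma queries_search ws st : basis M (base st) ->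
  (cost (search k sel ws st) <= size ws * (B * step_cost * k.+1 + 2))%N.
Proof.
elim: ws st => //= w ws IHws st bS; rewrite queries_bind queries_bind /= mulSn.
have := IHws _ (step_basis w bS).
have := queries_step k (sel w (base st)).1 (sel w (base st)).2 st.
have : ((size (sel w (base st)).1 + #|(sel w (base st)).2|) * step_cost * k.+1
         <= B * step_cost * k.+1)%N by rewrite !leq_mul2r sel_size ?orbT.
lia.
Qed.

Lemma queries_local_search K ws :
  (cost (local_search k K sel ws)
     <= #|N| + K * rank M * (B * step_cost * k.+1 + 2))%N.
Proof.
rewrite /local_search queries_bind queries_greedy -cardE leq_add2l.
have bS := greedy_basis f M.
apply: leq_trans (queries_search _ (st := start _) bS) _.
by rewrite leq_mul2r size_take (basis_card bS) geq_minl orbT.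
Qed.

End Search.
End LocalSearch.

(** * Averages and the approximation guarantee *)

Section Average.
Context {R : realType}.
Implicit Types W : finType.

Definition avg W (F : W -> R) : R := #|W|%:R^-1 * \sum_w F w.

Lemma avg_const W (c : R) : (0 < #|W|)%N -> avg (fun _ : W => c) = c.
Proof.
move=> W_gt0; rewrite /avg sumr_const -[c *+ _]mulr_natl mulrA mulVf ?mul1r //.
by rewrite pnatr_eq0 -lt0n.
Qed.

Lemma eq_avg W (F G : W -> R) : F =1 G -> avg F = avg G.
Proof. by move=> FG; congr (_ * _); apply: eq_bigr. Qed.

Lemma avg_ge0 W (F : W -> R) : (forall w, 0 <= F w) -> 0 <= avg F.
Proof. by move=> F_ge0; rewrite mulr_ge0 ?invr_ge0 ?ler0n // sumr_ge0. Qed.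

Lemma ler_avg W (F G : W -> R) : (forall w, F w <= G w) -> avg F <= avg G.
Proof.
by move=> FG; rewrite /avg ler_wpM2l ?invr_ge0 ?ler0n // ler_sum.
Qed.

Lemma avgD W (F G : W -> R) : avg (fun w => F w + G w) = avg F + avg G.
Proof. by rewrite /avg big_split mulrDr. Qed.

Lemma avgZ W (c : R) (F : W -> R) : avg (fun w => c * F w) = c * avg F.
Proof. by rewrite /avg -mulr_sumr mulrCA. Qed.

Lemma avg_pair W1 W2 (F : W1 * W2 -> R) :
  avg F = avg (fun w1 => avg (fun w2 => F (w1, w2))).
Proof.
rewrite /avg card_prod natrM invfM -mulrA; congr (_ * _).
by rewrite -mulr_sumr pair_bigA; congr (_ * _); apply: eq_bigr => -[].
Qed.

Lemma avgC W1 W2 (F : W1 -> W2 -> R) :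
  avg (fun w1 => avg (F w1)) = avg (fun w2 => avg (fun w1 => F w1 w2)).
Proof. by rewrite /avg -!mulr_sumr exchange_big mulrCA. Qed.

Lemma avg_tuple0 W (F : seq W -> R) : avg (fun t : 0.-tuple W => F t) = F [::].
Proof.
rewrite (eq_avg (G := fun=> F [::])) => [|t]; last by rewrite tuple0.
by rewrite avg_const // card_tuple expn0.
Qed.

Lemma avg_tupleS W n (F : seq W -> R) :
  avg (fun t : n.+1.-tuple W => F t) =
  avg (fun w => avg (fun t : n.-tuple W => F (w :: t))).
Proof.
rewrite -(avg_pair (fun p : W * n.-tuple W => F (p.1 :: p.2))) /avg.
rewrite card_prod !card_tuple expnS; congr (_ * _).
rewrite (reindex (fun p : W * n.-tuple W => [tuple of p.1 :: p.2])) //=.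
exists (fun t => (thead t, [tuple of behead t])) => [[w t] _|t _] /=.
  by congr (_, _); apply: val_inj.
by rewrite -tuple_eta.
Qed.

Lemma avg_take W m n (F : seq W -> R) : (0 < #|W|)%N -> (m <= n)%N ->
  avg (fun t : n.-tuple W => F (take m t)) = avg (fun t : m.-tuple W => F t).
Proof.
move=> W_gt0; elim: n m F => [|n IHn] [|m] F // lemn.
- by rewrite (avg_tuple0 (fun s => F (take 0 s))) avg_tuple0.
- rewrite avg_tuple0 (eq_avg (G := fun=> F [::])) => [|t]; last by rewrite take0.
  by rewrite avg_const // card_tuple expn_gt0 W_gt0.
- rewrite (avg_tupleS n (fun s => F (take m.+1 s))) avg_tupleS.
  by apply: eq_avg => w; rewrite -(IHn m (fun s => F (w :: s))).
Qed.

(* One more sample [u] improves the maximum by at least [X u], up to losing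
   what the other samples gave when [u] hits the support of [X]. *)
Lemma avg_max_sample W (X : W -> R) (D m : nat) :
    (0 < #|W|)%N -> (forall u, 0 <= X u) ->
    (#|[set u | X u != 0%R]| * m <= D * #|W|)%N ->
  m%:R * avg X <= D.+1%:R * avg (fun t : m.-tuple W => \big[Num.max/0]_(u <- t) X u).
Proof.
move=> W_gt0 X_ge0; set Z := [set u | _]; elim: m => [|m IHm] leD.
  rewrite mul0r mulr_ge0 ?ler0n //; apply: avg_ge0 => t.
  by rewrite tuple0 big_nil.
pose Y (t : seq W) := \big[Num.max/0]_(u <- t) X u.
have Y_ge0 t : 0 <= Y t.
  by rewrite /Y; elim/big_ind: _ => // x y x0 y0; rewrite le_max x0.
have {}IHm := IHm (leq_trans (leq_mul (leqnn _) (leqnSn m)) leD).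
set F := avg (fun t : m.-tuple W => _) in IHm.
have F_ge0 : 0 <= F by apply: avg_ge0 => t; exact: Y_ge0.
have W_gt0' : 0 < #|W|%:R :> R by rewrite ltr0n.
set p : R := #|Z|%:R / #|W|%:R.
have avgX_ge0 := avg_ge0 X_ge0.
(* Condition on the first sample [u]: inside the support [Z] the maximum is at least [X u], outside
   it is at least the maximum of the other samples. *)
have step : avg X + (1 - p) * F <= avg (fun t : m.+1.-tuple W => Y t).
  rewrite avg_tupleS.
  have -> : avg X + (1 - p) * F = avg (fun u => X u + F * (u \notin Z)%:R).
    rewrite avgD avgZ [_ * F]mulrC; congr (_ + _ * _).
    rewrite /avg (eq_bigr (fun u => 1 - (u \in Z)%:R)) => [|u _]; last first.
      by case: (u \in Z); rewrite ?subrr ?subr0.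
    rewrite sumrB sumr_const mulrBr mulVf ?gt_eqF //; congr (_ - _).
    by rewrite /p mulrC -natr_sum -[in LHS]sum1_card big_mkcond.
  apply: ler_avg => u; rewrite inE negbK.
  case: eqVneq => [->|Xu] /=; rewrite ?add0r ?mulr1 ?mulr0 ?addr0.
    by apply: ler_avg => t; rewrite /Y big_cons le_max lexx orbT.
  rewrite -[leLHS](avg_const (W := m.-tuple W)) ?card_tuple ?expn_gt0 ?W_gt0 //.
  by apply: ler_avg => t; rewrite /Y big_cons le_max lexx.
(* The expected number of samples that hit the support is at most [D]; the factor [D.+1] pays for
   these collisions. *)
have pm : p * m.+1%:R <= D%:R.
  by rewrite mulrAC ler_pdivrMr // -!natrM ler_nat.
have p_ge0 : 0 <= p by rewrite divr_ge0 ?ler0n.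
have p_le1 : p <= 1 by rewrite ler_pdivrMr // mul1r ler_nat max_card.
apply: le_trans (ler_wpM2l (ler0n _ _) step).
have p_le1' : 0 <= 1 - p by rewrite subr_ge0.
have := ler_wpM2l p_le1' IHm; have := ler_wpM2r avgX_ge0 pm.
have := mulr_ge0 p_ge0 avgX_ge0; rewrite -!natr1; lra.
Qed.

End Average.

Section MaxIndep.
Context {R : realType} {N : finType} (f : {set N} -> R) (M : matroid N).

Lemma max_indep_ge S : S \in indep M -> f S <= max_indep f M.
Proof. by move=> IS; rewrite /max_indep (le_bigmax_cond _ f IS). Qed.

Lemma max_indep_attained : exists2 S, S \in indep M & f S = max_indep f M.
Proof.
have I0 : set0 \in indep M.
  have /set0Pn[A IA] := indep_nonempty M.
  by apply: indep_down IA _; exact: sub0set.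
rewrite /max_indep; elim/big_ind: _ => [|x y [S IS <-] [T IT <-]|S IS].
- by exists set0.
- by case: leP => _; [exists T | exists S].
- by exists S.
Qed.

Lemma max_indep_basis S : set_monotone f -> basis M S ->
  exists2 O, basis M O & f O = max_indep f M.
Proof.
move=> fm bS; have [T IT fT] := max_indep_attained.
have leT : (#|T| <= #|S|)%N by rewrite (basis_card bS) indep_card_le.
have [O [IO sTO _ cO]] := indep_extend IT (basis_indep bS) leT.
exists O; first by rewrite /basis IO cO (basis_card bS) /=.
by apply/le_anti; rewrite max_indep_ge //= -fT fm.
Qed.

End MaxIndep.

(** * From expected progress to a bound on the output *)

Section Guarantee.
Context {R : realType} {N : finType} {ell : nat}.
Notation L := ell.+1.
Notation growth := (@growth R ell).
Notation state := (@state N ell).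
Variables (f : {set N} -> R) (M : matroid N).
Hypotheses (f0 : set_nonneg f) (fm : set_monotone f) (fs : submodular f).
Local Notation out := (output f M).
Local Notation Opt := (max_indep f M).

Definition total_weight : R := \sum_(J : {set 'I_L}) alpha ell #|J|.

Lemma potential_le (st : state) : basis M (base st) ->
  potential f st <= total_weight * Opt.
Proof.
move=> /basis_indep IS; rewrite mulr_suml; apply: ler_sum => J _.
rewrite ler_wpM2l ?alpha_ge0 //; apply: max_indep_ge.
by apply: indep_down IS _; exact: part_sub.
Qed.

(** The lower bound of [total_swap_gain] for an optimal basis; it is positive exactly when [f S] is
    below [1 - (growth ^+ L)^-1] times the optimum. *)
Definition deficit (S : {set N}) : R :=
  L%:R * ((growth ^+ L - 1) * Opt - growth ^+ L * f S).

(** Here [x o] is the linearized gain of swapping [o] for [h o], averaged over the colours of [o]. A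
    step tries all colours, so it gains at least this average. *)
Lemma matched_gains (st : state) : basis M (base st) ->
  exists (O : {set N}) (h : N -> N) (x : N -> R),
    [/\ #|O| = #|base st|, {in O &, injective h}, {in O, forall o, h o \in base st},
        deficit (base st) <= \sum_(o in O) x o
      & forall k (U : seq N) (V : {set N}) o,
          V \subset base st -> (#|V| <= 2 ^ k)%N ->
          o \in O -> o \in U -> h o \in V ->
          potential f st + x o <= potential f (out (step k U V st))].
Proof.
move=> bS; have [O bO fO] := max_indep_basis fm bS.
have [h [hinj hP]] := basis_matching bS bO.
have cO : #|O| = #|base st| by rewrite !(basis_card (M := M)).
have hO : h @: O = base st.
  apply/eqP; rewrite eqEcard card_in_imset // cO leqnn andbT.
  by apply/subsetP=> _ /imsetP[o oO ->]; have [] := hP o oO.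
pose x o := L%:R^-1 * (\sum_j add_gain f st o j) - del_loss f st (h o).
exists O, h, x; split=> //; first by move=> o /hP[].
  by rewrite /deficit -fO; exact: total_swap_gain.
move=> k U V o sVS size_V oO oU hoV; have [_ oN Io] := hP o oO.
have [_ _ best] := stepP fm fs U bS sVS size_V.
suff : L%:R^-1 * (\sum_j add_gain f st o j) <=
    potential f (out (step k U V st)) - potential f st + del_loss f st (h o).
  by rewrite /x; move: (L%:R^-1 * _) => y; lra.
set g := leRHS; rewrite mulrC ler_pdivrMr ?ltr0n // mulr_natr.
have -> : g *+ L = \sum_(j < L) g by rewrite sumr_const card_ord.
apply: ler_sum => j _; rewrite /g.
by have := best o (h o) j oU hoV oN Io; lra.
Qed.

Section Search.
Context {W : finType} (k : nat) (sel : W -> {set N} -> seq N * {set N}).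
Hypothesis sel_sub : forall w S, basis M S -> (sel w S).2 \subset S.
Hypothesis sel_exp : forall w S, basis M S -> (#|(sel w S).2| <= 2 ^ k)%N.
Local Notation step_sel w st :=
  (step k (sel w (base st)).1 (sel w (base st)).2 st).

(** Here the two algorithms differ: with [r] the rank, the exhaustive steps achieve [c = 1 / r] and
    the sampled ones [c = 1 / (8 * r)]. *)
Definition progress (c : R) := forall st : state, basis M (base st) ->
  potential f st + c * deficit (base st) <=
    avg (fun w => potential f (out (step_sel w st))).

(* Telescoping the potential bounds the total deficit of the visited bases,
   and the returned basis is at least as good as their average. *)
Lemma search_guarantee (c : R) n (st : state) :
    0 <= c -> (0 < #|W|)%N -> progress c -> basis M (base st) ->
  c * L%:R * (growth ^+ L - 1) * Opt * n%:R
    - (total_weight * Opt - potential f st) <=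
  c * L%:R * growth ^+ L * n%:R
    * avg (fun t : n.-tuple W => f (out (search k sel t st))).
Proof.
move=> c_ge0 W_gt0 prog; elim: n st => [|n IHn] st bS.
  by have := potential_le bS; rewrite !mulr0 mul0r; lra.
rewrite (avg_tupleS n (fun t => f (out (search k sel t st)))).
set A := c * L%:R * growth ^+ L.
have A_ge0 : 0 <= A.
  by rewrite !mulr_ge0 // exprn_ge0 // (le_trans _ (growth_ge1 _)).
rewrite -avgZ.
pose val w := avg (fun t : n.-tuple W => f (out (search k sel t (out (step_sel w st))))).
(* The output is worth at least [f (base st)] and at least what the remaining [n] steps find, so
   [n.+1] times its value dominates the first plus [n] times the second. *)
apply: (@le_trans _ _ (avg (fun w => A * (f (base st) + n%:R * val w)))); last first.
  apply: ler_avg => w; rewrite -mulrA ler_wpM2l //.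
  rewrite -[f (base st)](avg_const (W := n.-tuple W)) ?card_tuple ?expn_gt0 ?W_gt0 //.
  rewrite -!avgZ -avgD; apply: ler_avg => t; rewrite search_value.
  by rewrite -natr1 mulrDl mul1r addrC lerD // ?ler_wpM2l // le_max lexx ?orbT.
have bS' w := step_basis fm fs sel_sub sel_exp w bS.
have := ler_avg (fun w => IHn _ (bS' w)).
have := prog st bS.
rewrite /deficit; set P := avg (fun w => potential _ _); set V := avg (fun w => A * _).
have -> : V = A * f (base st) + A * n%:R * avg val.
  by rewrite /V avgZ avgD avgZ avg_const // mulrDr mulrA.
rewrite avgZ -/val; set F := avg (fun w => _ - _).
have -> : F = c * L%:R * (growth ^+ L - 1) * Opt * n%:R - total_weight * Opt + P.
  rewrite (_ : F = avg (fun w => (c * L%:R * (growth ^+ L - 1) * Opt * n%:R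
      - total_weight * Opt) + potential f (out (step_sel w st)))).
    by rewrite avgD avg_const.
  by apply: eq_avg => w; ring.
rewrite -natr1 /A; set v := avg val.
lra.
Qed.

End Search.
End Guarantee.

(** * Exhaustive and sampled neighbourhoods *)

Section Approximation.
Context {R : realType} {N : finType} {ell : nat}.
Notation L := ell.+1.
Notation growth := (@growth R ell).
Notation state := (@state N ell).
Notation total_weight := (@total_weight R ell).
Variables (f : {set N} -> R) (M : matroid N).
Hypotheses (f0 : set_nonneg f) (fm : set_monotone f) (fs : submodular f).
Local Notation out := (output f M).
Local Notation Opt := (max_indep f M).

Lemma total_weight_ge0 : 0 <= total_weight.
Proof. by apply: sumr_ge0 => J _; exact: alpha_ge0. Qed.

Lemma potential_ge0 (st : state) : 0 <= potential f st.
Proof. by apply: sumr_ge0 => J _; rewrite mulr_ge0 ?alpha_ge0. Qed.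

Lemma max_indep_ge0 : 0 <= Opt.
Proof. by have [T _ <-] := max_indep_attained f M. Qed.

Section Selection.
Context {W : finType} (k : nat) (sel : W -> {set N} -> seq N * {set N}).
Hypothesis sel_sub : forall w S, basis M S -> (sel w S).2 \subset S.
Hypothesis sel_exp : forall w S, basis M S -> (#|(sel w S).2| <= 2 ^ k)%N.

Lemma local_search_basis K (ws : seq W) :
  basis M (out (@local_search R N ell W k K sel ws)).
Proof.
rewrite /local_search output_bind; apply: search_basis => //=.
exact: greedy_basis.
Qed.

(** The [K * rank M] steps together weigh the deficits by [K / e], while the potential rises by at
    most [total_weight * Opt]; the quotient is the error term. *)
Lemma local_search_guarantee (K e : nat) :
    (0 < K)%N -> (0 < e)%N -> (0 < #|{: (K * #|N|).-tuple W}|)%N ->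
    ((0 < rank M)%N ->
      (0 < #|W|)%N /\ @progress R N ell f M W k sel (e * rank M)%:R^-1) ->
  (1 - (growth ^+ L)^-1 - e%:R * total_weight / K%:R) * Opt <=
  avg (fun t : (K * #|N|).-tuple W => f (out (@local_search R N ell W k K sel t))).
Proof.
move=> K_gt0 e_gt0 seed_gt0 prog.
have bS := greedy_basis f M; set S := out _ in bS.
have Q_ge1 : 1 <= growth ^+ L by rewrite exprn_ege1 // growth_ge1.
have [OptS0 GS0] := (max_indep_ge0, total_weight_ge0).
have K_gt0' : 0 < K%:R :> R by rewrite ltr0n.
have e_gt0' : 0 < e%:R :> R by rewrite ltr0n.
under eq_avg => t do rewrite /local_search output_bind -/S (basis_card bS).
(* In rank 0 the empty set is the only independent set and no step is made. *)
have [r0|] := posnP (rank M).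
  rewrite r0 muln0 (eq_avg (G := fun=> f S)) => [|t]; last by rewrite take0.
  rewrite avg_const //.
  have set0E A : A \in indep M -> A = set0.
    by move/indep_card_le; rewrite r0 leqn0 cards_eq0 => /eqP.
  have [T IT <-] := max_indep_attained f M.
  rewrite (set0E T IT) (set0E S (basis_indep bS)) ler_piMl //.
  have : 0 <= (growth ^+ L)^-1 by rewrite invr_ge0; lra.
  have : 0 <= e%:R * total_weight / K%:R by rewrite divr_ge0 ?mulr_ge0 // ltW.
  lra.
move=> r_gt0; have [W_gt0 {}prog] := prog r_gt0.
have leKr : (K * rank M <= K * #|N|)%N.
  by rewrite leq_mul2l -(basis_card bS) max_card orbT.
rewrite (avg_take (fun s => f (out (search k sel s (start S)))) W_gt0 leKr).
set V := avg _.
have := search_guarantee fm fs sel_sub sel_exp (K * rank M)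
  _ W_gt0 prog (st := start S) bS.
rewrite invr_ge0 ler0n -/V => /(_ isT).
have := potential_ge0 (start S); set P := potential _ _.
pose a : R := K%:R / e%:R.
have a_gt0 : 0 < a by rewrite divr_gt0.
have eT : (e * rank M)%:R^-1 * (K * rank M)%:R = a.
  rewrite !natrM invfM mulrACA [_^-1 * _]mulrC mulVf ?mulr1 //.
  by rewrite gt_eqF // ltr0n.
have -> : e%:R * total_weight / K%:R = total_weight / a.
  by rewrite /a invf_div; ring.
set Q := growth ^+ L in Q_ge1 *.
have -> : (e * rank M)%:R^-1 * L%:R * (Q - 1) * Opt * (K * rank M)%:R
    = L%:R * a * (Q - 1) * Opt by rewrite -eT; ring.
have -> : (e * rank M)%:R^-1 * L%:R * Q * (K * rank M)%:R * V
    = L%:R * a * Q * V by rewrite -eT; ring.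
have L_ge1 : 1 <= L%:R :> R by rewrite ler1n.
have Q_gt0 : 0 < Q by exact: lt_le_trans Q_ge1.
have LaQ_gt0 := mulr_gt0 (mulr_gt0 (lt_le_trans ltr01 L_ge1) a_gt0) Q_gt0.
move=> P_ge0 guarantee; rewrite -(ler_pM2l LaQ_gt0).
have -> : L%:R * a * Q * ((1 - Q^-1 - total_weight / a) * Opt) =
    L%:R * a * (Q - 1) * Opt - L%:R * Q * (total_weight * Opt).
  by field; rewrite !gt_eqF //; lra.
have : total_weight * Opt <= L%:R * Q * (total_weight * Opt).
  rewrite ler_peMl ?mulr_ge0 // (le_trans L_ge1) // ler_peMr // ltW // (lt_le_trans ltr01).
lra.
Qed.

End Selection.
End Approximation.

(** The class has at least [n %/ b] members, which is at least half of [n / b] since [b <= n]. A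
    uniform index reduced modulo the number of blocks thus hits each block with probability at least
    [1 / (2 * b)]. *)
Lemma card_mod_eq n b c : (c < b <= n)%N ->
  (n <= 2 * b * #|[set j : 'I_n | (j %% b == c)%N]|)%N.
Proof.
move=> /andP[ltcb lebn]; have b_gt0 : (0 < b)%N by apply: leq_ltn_trans ltcb.
have : (n %/ b <= #|[set j : 'I_n | (j %% b == c)%N]|)%N.
  rewrite -(size_iota 0 (n %/ b)) -(size_map (fun i => c + i * b)%N) cardE.
  rewrite -(size_map val); apply: uniq_leq_size.
    rewrite map_inj_uniq ?iota_uniq // => i j /eqP.
    by rewrite eqn_add2l eqn_pmul2r // => /eqP.
  move=> x /mapP[i]; rewrite mem_iota add0n => /andP[_ lti] ->.
  have lt_n : (c + i * b < n)%N.
    apply: (@leq_trans (i.+1 * b)); first by rewrite mulSn ltn_add2r.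
    by apply: leq_trans (leq_divM n b); rewrite leq_mul2r lti orbT.
  apply/mapP; exists (Ordinal lt_n) => //.
  by rewrite mem_enum inE /= addnC modnMDl modn_small.
have : (0 < n %/ b)%N by rewrite divn_gt0.
have := ltn_ceil n b_gt0; nia.
Qed.

Section Blocks.
Context {N : finType}.
Implicit Types S : {set N}.

(** The ceiling of [#|S| / q] for non-empty [S] and positive [q], written so that it is never 0. *)
Definition nblocks q S : nat := (#|S|.-1 %/ q).+1.

Definition block q S (j : nat) : {set N} :=
  [set v in S | (index v (enum S) %/ q == j %% nblocks q S)%N].

Lemma block_sub q S j : block q S j \subset S.
Proof. by apply/subsetP=> v; rewrite inE => /andP[]. Qed.

Lemma card_block q S j : (0 < q)%N -> (#|block q S j| <= q)%N.
Proof.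
move=> q_gt0; rewrite cardE -(size_map (fun v => index v (enum S) %% q)%N).
rewrite -[leqRHS](size_iota 0); apply: uniq_leq_size.
  rewrite map_inj_in_uniq ?enum_uniq // => u v.
  rewrite !mem_enum !inE => /andP[uS /eqP qu] /andP[vS /eqP qv] eq_mod.
  have : index u (enum S) = index v (enum S).
    by rewrite (divn_eq (index u _) q) (divn_eq (index v _) q) qu qv eq_mod.
  by move=> /(congr1 (nth u (enum S))); rewrite !nth_index ?mem_enum.
by move=> x /mapP[v _ ->]; rewrite mem_iota ltn_mod.
Qed.

Lemma nblocks_le q S : (0 < #|S|)%N -> (nblocks q S <= #|S|)%N.
Proof. by move=> S_gt0; rewrite /nblocks -(prednK S_gt0) ltnS leq_div. Qed.

Lemma card_in_block q S n v : v \in S -> (#|S| <= n)%N ->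
  (n <= 2 * nblocks q S * #|[set j : 'I_n | v \in block q S j]|)%N.
Proof.
move=> vS leSn; have S_gt0 : (0 < #|S|)%N by apply/card_gt0P; exists v.
have lt_c : (index v (enum S) %/ q < nblocks q S)%N.
  rewrite ltnS leq_div2r // -ltnS prednK // cardE index_mem mem_enum //.
have := @card_mod_eq n (nblocks q S) (index v (enum S) %/ q).
rewrite lt_c (leq_trans (nblocks_le q S_gt0)) // => /(_ isT).
by congr (_ <= _ * _)%N; apply: eq_card => j; rewrite !inE vS eq_sym.
Qed.

Lemma card_block_nblocks q S j : (0 < q)%N ->
  (#|block q S j| * nblocks q S <= 2 * #|S|)%N.
Proof.
move=> q_gt0; rewrite /nblocks mulnS mul2n -addnn leq_add //.
  exact/subset_leq_card/block_sub.
apply: leq_trans (leq_mul (card_block S j q_gt0) (leqnn _)) _.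
by rewrite mulnC; apply: leq_trans (leq_divM _ _) _; exact: leq_pred.
Qed.

End Blocks.

(** * Progress of an exhaustive step *)

Section Deterministic.
Context {R : realType} {N : finType} {ell : nat}.
Notation state := (@state N ell).
Variables (f : {set N} -> R) (M : matroid N).
Hypotheses (f0 : set_nonneg f) (fm : set_monotone f) (fs : submodular f).

Definition exhaustive (_ : unit) (S : {set N}) := (enum N, S).

Lemma exhaustive_progress k : (0 < rank M)%N -> (#|N| <= 2 ^ k)%N ->
  @progress R N ell f M _ k exhaustive (1 * rank M)%:R^-1.
Proof.
move=> r_gt0 leN st bS; rewrite mul1n.
rewrite (eq_avg (G := fun=> potential f (output f M (step k (enum N) (base st) st)))) //.
rewrite avg_const ?card_unit //.
have [O [h [x [cO _ hS le_x best]]]] := matched_gains f0 fm fs bS.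
have r_gt0' : 0 < (rank M)%:R :> R by rewrite ltr0n.
rewrite addrC -lerBrDr [_^-1 * _]mulrC ler_pdivrMr //.
apply: le_trans le_x _.
rewrite mulr_natr -(basis_card bS) -cO -sumr_const; apply: ler_sum => o oO.
rewrite lerBrDl; apply: best => //; rewrite ?mem_enum ?hS //.
exact: leq_trans (max_card _) leN.
Qed.

End Deterministic.

(** * Progress of random samples against a random block *)

Section Randomized.
Context {R : realType} {N : finType} {ell : nat}.
Notation state := (@state N ell).
Variables (f : {set N} -> R) (M : matroid N).
Hypotheses (f0 : set_nonneg f) (fm : set_monotone f) (fs : submodular f).
Local Notation n := #|N|.

(* [nsamples * #|S| >= n * nblocks], while a block contains at most
   [3 * n / nsamples] elements, so that few samples compete for the same block. *)
Definition nsamples q (S : {set N}) : nat := (n * nblocks q S %/ #|S|).+1.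

Notation seed := ((n * n).+1.-tuple N * 'I_n)%type.

(** The seed type is fixed before the rank is known, so it holds as many samples as any non-empty
    [S] may require. *)
Definition sampled q (w : seed) (S : {set N}) : seq N * {set N} :=
  (take (nsamples q S) w.1, block q S w.2).

Lemma nsamples_le q (S : {set N}) : (0 < #|S|)%N -> (nsamples q S <= (n * n).+1)%N.
Proof.
move=> S_gt0; rewrite /nsamples ltnS; apply: leq_trans (leq_div _ _) _.
by rewrite leq_mul2l (leq_trans (nblocks_le q S_gt0)) ?orbT // max_card.
Qed.

Lemma block_nsamples q (S : {set N}) j : (0 < q)%N -> (0 < #|S|)%N ->
  (#|block q S j| * nsamples q S <= 3 * n)%N.
Proof.
move=> q_gt0 S_gt0; have leS : (#|S| <= n)%N := max_card _.
have leb : (#|block q S j| <= #|S|)%N := subset_leq_card (block_sub _ _ _).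
rewrite /nsamples mulnS (_ : 3 = 1 + 2)%N // mulnDl mul1n leq_add //.
  exact: leq_trans leb leS.
rewrite -(leq_pmul2r S_gt0) -mulnA; apply: leq_trans (leq_mul (leqnn _) (leq_divM _ _)) _.
by have := card_block_nblocks S j q_gt0; nia.
Qed.

(** The factor 8 is [2 * 4]: the block of [h o] is drawn with probability at least [1 / (2 * b)],
    and [avg_max_sample] with [D = 3] loses a factor 4. *)
Lemma sampled_progress k q : (0 < rank M)%N -> (0 < q)%N -> (n <= 2 ^ k)%N ->
  @progress R N ell f M _ k (sampled q) (8 * rank M)%:R^-1.
Proof.
move=> r_gt0 q_gt0 leN st bS; set S := base st in bS *.
have [O [h [x [cO hinj hS le_x best]]]] := matched_gains f0 fm fs bS.
rewrite -/S in cO hS le_x best.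
have cS : #|S| = rank M := basis_card bS.
have S_gt0 : (0 < #|S|)%N by rewrite cS.
have leSn : (#|S| <= n)%N := max_card _.
have n_gt0 : (0 < n)%N := leq_trans S_gt0 leSn.
set m := nsamples q S; set b := nblocks q S.
(* The gain of sample [u] when block [j] is drawn, cut off at 0 because a step may stay. *)
pose X j u : R := if (u \in O) && (h u \in block q S j) then Num.max 0 (x u) else 0.
have X_ge0 j u : 0 <= X j u by rewrite /X; case: ifP; rewrite ?le_max ?lexx.
pose mx j (t : seq N) := \big[Num.max/0]_(u <- t) X j u.
have size_b j : (#|block q S j| <= 2 ^ k)%N.
  by apply: leq_trans (subset_leq_card (block_sub _ _ _)) (leq_trans leSn leN).
have stay U (V : {set N}) : V \subset S -> (#|V| <= 2 ^ k)%N ->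
    potential f st <= potential f (output f M (step k U V st)).
  by move=> sVS leV; have [] := stepP fm fs U bS sVS leV.
have gain_mx (w : seed) : potential f st + mx w.2 (take m w.1) <=
    potential f (output f M (step k (sampled q w S).1 (sampled q w S).2 st)).
  have stay0 := stay (sampled q w S).1 _ (block_sub q S w.2) (size_b w.2).
  rewrite -lerBrDl /mx big_seq; apply: bigmax_le => [|u uU]; first by rewrite subr_ge0.
  rewrite lerBrDl /X; case: ifP => [/andP[uO huV]|_]; last by rewrite addr0.
  rewrite maxEle; case: ifP => _; last by rewrite addr0.
  exact: (best _ _ _ _ (block_sub q S w.2) (size_b w.2) uO uU huV).
apply: le_trans (ler_avg gain_mx); rewrite avgD avg_const; last first.
  by rewrite card_prod card_tuple card_ord muln_gt0 expn_gt0 n_gt0.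
rewrite lerD2l avg_pair avgC /=.
under eq_avg => j do rewrite (avg_take (mx j) n_gt0 (nsamples_le q S_gt0)).
have sample j : m%:R * avg (X j) <= 4%:R * avg (fun t : m.-tuple N => mx j t).
  apply: avg_max_sample => //; apply: leq_trans (block_nsamples j q_gt0 S_gt0).
  rewrite leq_mul2r; apply/orP; right.
  (* The injection [h] sends the support of [X j] into the block, so the support is no larger than
     the block. *)
  have sub : [set u | X j u != 0] \subset [set u in O | h u \in block q S j].
    by apply/subsetP=> u; rewrite in_set in_set /X; case: ifP => // _; rewrite eqxx.
  apply: leq_trans (subset_leq_card sub) _.
  rewrite -(card_in_imset (f := h)) => [|u v]; last first.
    by rewrite !inE => /andP[uO _] /andP[vO _]; exact: hinj.
  apply: subset_leq_card; apply/subsetP=> v /imsetP[u].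
  by rewrite [u \in _]inE => /andP[_ hu] ->.
pose y u : R := if u \in O then Num.max 0 (x u) else 0.
have n_gt0' : 0 < n%:R :> R by rewrite ltr0n.
have hit u : y u <= (2 * b)%:R * avg (fun j : 'I_n => X j u).
  rewrite /y /X; case: ifP => uO /=; last first.
    by rewrite mulr_ge0 ?ler0n //; apply: avg_ge0.
  set c := Num.max _ _; have c_ge0 : 0 <= c by rewrite le_max lexx.
  have -> : avg (fun j : 'I_n => if h u \in block q S j then c else 0)
      = c * #|[set j : 'I_n | h u \in block q S j]|%:R / n%:R.
    by rewrite /avg card_ord mulrC -big_mkcond sumr_const mulr_natr cardsE.
  rewrite mulrA ler_pdivlMr // mulrCA ler_wpM2l // -natrM ler_nat.
  exact: card_in_block (hS u uO) leSn.
set A := avg _.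
have yO : \sum_(o in O) Num.max 0 (x o) = n%:R * avg y.
  by rewrite /avg mulVKf ?gt_eqF // big_mkcond.
have step1 : n%:R * avg y <= (2 * b * n)%:R * avg (fun j : 'I_n => avg (X j)).
  rewrite natrM [_ * n%:R]mulrC -mulrA ler_wpM2l // [in leRHS]avgC -avgZ.
  exact: ler_avg.
have step2 : m%:R * avg (fun j : 'I_n => avg (X j)) <= 4%:R * A.
  by rewrite /A -!avgZ; exact: ler_avg.
have le_y : @deficit R N ell f M S <= n%:R * avg y.
  apply: le_trans le_x _; rewrite -yO; apply: ler_sum => o _.
  by rewrite le_max lexx orbT.
have m_ge : (n * b <= m * #|S|)%N by rewrite ltnW // ltn_ceil.
have r_gt0' : 0 < (8 * rank M)%:R :> R by rewrite ltr0n muln_gt0.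
rewrite mulrC ler_pdivrMr //; apply: le_trans le_y _; apply: le_trans step1 _.
have B_ge0 : 0 <= avg (fun j : 'I_n => avg (X j)) by apply: avg_ge0 => j; apply: avg_ge0.
apply: (@le_trans _ _ ((2 * (m * #|S|))%:R * avg (fun j : 'I_n => avg (X j)))).
  by rewrite ler_wpM2r // ler_nat -mulnA leq_mul2l mulnC m_ge.
rewrite mulnCA natrM mulrAC; apply: le_trans (ler_wpM2r (ler0n _ _) step2) _.
by rewrite cS mulrAC -natrM mulrC mulnA.
Qed.

End Randomized.

(** * Query counts and choice of parameters *)

Section Constants.
Context {R : realType}.

(** With [L = ell.+1], the inverse of [g] is [1 - 1 / (L + 1)], at most [exp (- 1 / (L + 1))]. Hence
    [e <= g ^ (L + 1)], and the inverse of [g ^ L] is at most [g / e]. *)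
Lemma growth_bound ell :
  (@growth R ell ^+ ell.+1)^-1 <= (expR 1)^-1 + ell.+1%:R^-1.
Proof.
set g := growth ell; have L_gt0 : 0 < ell.+1%:R :> R by rewrite ltr0n.
have g_gt0 : 0 < g := lt_le_trans ltr01 (growth_ge1 ell).
have gV : g^-1 <= expR (- ell.+2%:R^-1).
  apply: le_trans (expR_ge1Dx _).
  have -> : ell.+2%:R = ell.+1%:R + 1 :> R by rewrite natr1.
  move: L_gt0; rewrite /g /growth; move: ell.+1%:R => a a_gt0.
  rewrite le_eqVlt; apply/orP; left; apply/eqP; field.
  by rewrite !gt_eqF //; lra.
have e_le : expR 1 <= g ^+ ell.+2.
  have -> : expR 1 = expR (ell.+2%:R^-1) ^+ ell.+2 :> R.
    by rewrite -expRM_natl mulfV // pnatr_eq0.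
  rewrite lerXn2r ?nnegrE ?expR_ge0 ?(ltW g_gt0) //.
  by rewrite -[leRHS]invrK -[expR _]invrK lef_pV2 ?posrE ?invr_gt0 ?expR_gt0 // -expRN.
have e_ge1 : 1 <= expR 1 :> R by rewrite -[leLHS]expR0 ler_expR.
have e_gt0 : 0 < expR 1 :> R := expR_gt0 1.
apply: (@le_trans _ _ (g / expR 1)).
  by rewrite ler_pdivlMr // [_ * expR 1]mulrC ler_pdivrMr ?exprn_gt0 // -exprS.
rewrite /g /growth mulrDl mul1r lerD2l ler_piMr ?invr_ge0 ?ler0n //.
by rewrite invf_le1.
Qed.

(** One half of [eps] pays for the finite number of colours, the other for the finite number of
    rounds. *)
Lemma ratio_bound ell (e K : nat) (eps : R) : 0 < eps ->
    2 / eps < ell.+1%:R -> 2 * e%:R * @total_weight R ell / eps < K%:R ->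
  1 - (expR 1)^-1 - eps <=
  1 - (@growth R ell ^+ ell.+1)^-1 - e%:R * @total_weight R ell / K%:R.
Proof.
move=> eps_gt0 lt_ell lt_K; have := growth_bound ell.
have tw_ge0 := @total_weight_ge0 R ell.
have L_gt0 : 0 < ell.+1%:R :> R by rewrite ltr0n.
have K_gt0 : 0 < K%:R :> R.
  by apply: le_lt_trans lt_K; rewrite divr_ge0 ?mulr_ge0 // ltW.
have : ell.+1%:R^-1 <= eps / 2.
  rewrite -[leRHS]invf_div lef_pV2 ?posrE ?divr_gt0 //; exact: ltW.
have : e%:R * @total_weight R ell / K%:R <= eps / 2.
  rewrite ler_pdivrMr // mulrAC ler_pdivlMr //.
  by move: lt_K; rewrite ltr_pdivrMr // => /ltW; lra.
set a := _ / K%:R; set b := (growth _ ^+ _)^-1; set c := (expR 1)^-1.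
by set d := ell.+1%:R^-1; clearbody a b c d; lra.
Qed.

(** Turns the factor [(log_card N).+1] of the binary searches into the natural logarithm of
    [polylog]. *)
Lemma log_bound n : (trunc_log 2 n).+2%:R * ln 2 <= 3 * ln (n.+2%:R) :> R.
Proof.
have ln2_le : ln 2 <= ln (n.+2%:R) :> R.
  by rewrite ler_ln ?posrE ?ltr0n // ler_nat.
have : (trunc_log 2 n)%:R * ln 2 <= ln (n.+2%:R) :> R.
  rewrite mulr_natl -lnXn ?ltr0n // -natrX ler_ln ?posrE ?ltr0n ?expn_gt0 // ler_nat.
  case: n {ln2_le} => [|n]; first by rewrite trunc_log0.
  exact: leq_trans (trunc_logP _ _) (leq_trans (leqnSn _) (leqnSn _)).
have -> : (trunc_log 2 n).+2%:R = (trunc_log 2 n)%:R + 2 :> R by rewrite -addn2 natrD.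
rewrite mulrDl; set c := _ * ln 2; move: ln2_le; set a := ln 2; set b := ln _.
by clearbody a b c; lra.
Qed.

Definition isqrt (n : nat) : nat := Num.truncn (Num.sqrt n%:R : R).

Lemma isqrt_le n : (isqrt n)%:R <= Num.sqrt n%:R :> R.
Proof. by have /andP[] := truncn_itv (sqrtr_ge0 (n%:R : R)). Qed.

Lemma isqrt_gt n : (n < (isqrt n).+1 ^ 2)%N.
Proof.
have /andP[_ lt_s] := truncn_itv (sqrtr_ge0 (n%:R : R)).
rewrite -(ltr_nat R) natrX -[X in X < _](sqr_sqrtr (ler0n R n)).
by rewrite ltrXn2r ?nnegrE ?sqrtr_ge0.
Qed.

Lemma isqrt_gt0 n : (0 < n)%N -> (0 < isqrt n)%N.
Proof.
by have := isqrt_gt n; case: (isqrt n) => // n_lt1; rewrite lt0n -leqn0 -ltnS n_lt1.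
Qed.

Lemma isqrt_quad n : (n <= 4 * (isqrt n * isqrt n))%N.
Proof.
case: (posnP n) => [-> //|/isqrt_gt0 s_gt0].
by have := isqrt_gt n; move: (isqrt n) s_gt0 => s; nia.
Qed.

End Constants.

Section Uniform.
Context {R : realType} {N : finType} {T : Type} (W : finType).
Hypothesis W_gt0 : (0 < #|W|)%N.

Lemma uniform_ge0 (w : W) : 0 <= #|W|%:R^-1 :> R.
Proof. by rewrite invr_ge0. Qed.

Lemma uniform_sum1 : \sum_(w : W) #|W|%:R^-1 = 1 :> R.
Proof. by have := avg_const (1 : R) W_gt0; rewrite /avg mulr_sumr mulr1. Qed.

Definition uniform_algo (run : W -> det_algo R N T) : rand_algo R N T :=
  RandAlgo uniform_ge0 uniform_sum1 run.

End Uniform.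

Lemma expected_value_uniform (R : realType) (N : finType) (W : finType)
    (W_gt0 : (0 < #|W|)%N) (run : W -> det_algo R N {set N}) f M :
  expected_value f M (uniform_algo W_gt0 run) = avg (fun w => f (output f M (run w))).
Proof. by rewrite /expected_value /avg mulr_sumr. Qed.

Section Cost.
Context {R : realType} {N : finType} {ell : nat}.
Variables (f : {set N} -> R) (M : matroid N).
Hypotheses (fm : set_monotone f) (fs : submodular f).
Local Notation n := #|N|.
Local Notation r := (rank M).

Lemma rank_le : (r <= n)%N.
Proof. by rewrite -(basis_card (greedy_basis f M)) max_card. Qed.

Lemma cost_le m K a B c k d X : (0 < k)%N -> (m <= X)%N -> (a <= X)%N ->
    (a * B <= d * X)%N ->
  (m + K * a * (B * c * k + 2) <= (1 + d * K * c + 2 * K) * (k * X))%N.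
Proof.
move=> k_gt0 lem lea leB; have leX : (X <= k * X)%N by rewrite leq_pmull.
rewrite !mulnDl mul1n mulnDr addnA; apply: leq_add; first apply: leq_add.
- exact: leq_trans lem leX.
- rewrite (_ : K * a * (B * c * k) = K * c * k * (a * B))%N; last by ring.
  rewrite (_ : d * K * c * (k * X) = K * c * k * (d * X))%N; last by ring.
  by rewrite leq_mul2l leB orbT.
- rewrite addn0 -mulnDr -mulnA leq_mul2l; apply/orP; right.
  by rewrite muln2 -addnn; apply: leq_add; exact: leq_trans lea leX.
Qed.

Lemma queries_exhaustive k K (ws : seq unit) : (n <= 2 ^ k)%N ->
  (queries f M (@local_search R N ell _ k K exhaustive ws)
     <= (1 + 2 * K * @step_cost ell + 2 * K) * (k.+1 * (n * maxn r 1)))%N.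
Proof.
move=> leN.
apply: leq_trans (@queries_local_search R N ell f M fm fs unit k (2 * n)
  exhaustive _ _ _ K ws) _.
- by move=> w S _; exact: subxx.
- by move=> w S _; exact: leq_trans (max_card _) leN.
- by move=> w S _; rewrite -cardE mul2n -addnn leq_add2l max_card.
(* The maximum with 1 covers the greedy queries in rank 0. *)
have r1_gt0 : (0 < maxn r 1)%N by rewrite leq_max orbT.
have leX : (n <= n * maxn r 1)%N by rewrite leq_pmulr.
apply: cost_le => //; first exact: leq_trans rank_le leX.
by rewrite mulnCA [(r * n)%N]mulnC !leq_mul2l leq_maxl !orbT.
Qed.

Definition sampled_size q : nat :=
  ((n * (r.-1 %/ q).+1 %/ r).+1 + q)%N.

Lemma sampled_sizeP q w (S : {set N}) : (n <= 4 * (q * q))%N -> basis M S ->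
  (size (sampled q w S).1 + #|(sampled q w S).2| <= sampled_size q)%N.
Proof.
move=> n_le bS; apply: leq_add => /=.
  by rewrite size_take_min geq_min /nsamples /nblocks (basis_card bS) leqnn.
case: (posnP q) => [q0|q_gt0]; last exact: card_block.
apply: leq_trans (max_card _) _.
by move: n_le; rewrite q0 muln0.
Qed.

(** Over about [r] steps the blocks cost [r * q] and the samples about [n + n * r / q]; for [q] of
    order the square root of [n], the term [n * r / q] is at most [4 * r * q]. *)
Lemma rank_sampled_size q : (n <= 4 * (q * q))%N ->
  (r * sampled_size q <= 6 * (n + r * q))%N.
Proof.
move=> n_le; rewrite /sampled_size mulnDr mulnS.
have := leq_divM (n * (r.-1 %/ q).+1) r; rewrite mulnC mulnS.
have nd : (n * (r.-1 %/ q) <= 4 * (q * r))%N.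
  apply: leq_trans (leq_mul n_le (leqnn _)) _.
  rewrite -!mulnA !leq_mul2l /= [(q * (_ %/ _))%N]mulnC; apply/orP; right.
  exact: leq_trans (leq_divM _ _) (leq_pred _).
have := rank_le; rewrite [(r * q)%N]mulnC; move: nd.
case: (posnP q) => [q0|q_gt0]; first by move: n_le; rewrite q0; lia.
have : (r <= q * r)%N by rewrite leq_pmull.
set a := (n * (_ %/ _))%N; set b := (r * (_ %/ _))%N; set c := (q * r)%N.
by clearbody a b c; lia.
Qed.

Lemma queries_sampled k K q ws : (n <= 2 ^ k)%N -> (n <= 4 * (q * q))%N ->
  (queries f M (@local_search R N ell _ k K (sampled q) ws)
     <= (1 + 6 * K * @step_cost ell + 2 * K) * (k.+1 * (n + r * q)))%N.
Proof.
move=> leN n_le.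
apply: leq_trans (@queries_local_search R N ell f M fm fs _ k (sampled_size q)
  (sampled q) _ _ _ K ws) _.
- by move=> w S _; exact: block_sub.
- by move=> w S _; exact: leq_trans (max_card _) leN.
- by move=> w S; exact: sampled_sizeP.
apply: cost_le; rewrite ?leq_addr //; first exact: leq_trans rank_le (leq_addr _ _).
exact: rank_sampled_size.
Qed.

End Cost.

(** * The two algorithms with their parameters *)

Section Algorithms.
Context {R : realType}.
Implicit Types (eps : R) (N : finType).

(* The search uses [(colours eps).+1] colours. *)
Definition colours eps : nat := Num.bound (2 / eps).

Definition rounds (e : nat) eps : nat :=
  Num.bound (2 * e%:R * @total_weight R (colours eps) / eps).

Definition log_card N : nat := (trunc_log 2 #|N|).+1.

Definition det_search eps N : det_algo R N {set N} :=
  @local_search R N (colours eps) _ (log_card N) (rounds 1 eps) exhaustive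
    (nseq (rounds 1 eps * #|N|) tt).

Definition sample_seed N : finType := ((#|N| * #|N|).+1.-tuple N * 'I_#|N|)%type.

Lemma sample_seed_gt0 N : (0 < #|N|)%N -> (0 < #|sample_seed N|)%N.
Proof. by move=> N_gt0; rewrite card_prod card_tuple card_ord muln_gt0 expn_gt0 N_gt0. Qed.

Lemma sample_seeds_gt0 K N : (0 < #|{: (K * #|N|).-tuple (sample_seed N)}|)%N.
Proof.
(* On an empty ground set there are no sample seeds, but the empty tuple still exists. *)
rewrite card_tuple expn_gt0; have [-> | N_gt0] := posnP #|N|; first by rewrite muln0 orbT.
by rewrite sample_seed_gt0.
Qed.

Definition rand_search eps N : rand_algo R N {set N} :=
  uniform_algo (sample_seeds_gt0 (rounds 8 eps) N) (fun t =>
    @local_search R N (colours eps) _ (log_card N) (rounds 8 eps)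
      (sampled (@isqrt R #|N|)) t).

Lemma leq_log_card N : (#|N| <= 2 ^ log_card N)%N.
Proof. exact/ltnW/trunc_log_ltn. Qed.

Lemma ratio_rounds e eps : 0 < eps ->
  1 - (expR 1)^-1 - eps <=
    1 - (@growth R (colours eps) ^+ (colours eps).+1)^-1
      - e%:R * @total_weight R (colours eps) / (rounds e eps)%:R.
Proof.
move=> eps_gt0; apply: ratio_bound => //.
  apply: lt_le_trans (archi_boundP _) _; first by rewrite divr_ge0 // ltW.
  by rewrite ler_nat leqnSn.
by apply: archi_boundP; rewrite divr_ge0 ?mulr_ge0 ?total_weight_ge0 // ltW.
Qed.

(** A deterministic run is an average over a one-point seed space, so [local_search_guarantee]
    serves both algorithms. *)
Lemma avg_tuple_unit n (F : seq unit -> R) :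
  avg (fun t : n.-tuple unit => F t) = F (nseq n tt).
Proof.
rewrite (eq_avg (G := fun=> F (nseq n tt))) => [|t]; last first.
  by congr F; apply: (@eq_from_nth _ tt) => [|i _]; rewrite ?size_tuple ?size_nseq //;
    case: (nth _ _ _); case: (nth _ _ _).
by rewrite avg_const // card_tuple card_unit exp1n.
Qed.

Lemma polylog_bound N (D X Q : nat) : (Q <= D * ((log_card N).+1 * X))%N ->
  Q%:R <= D%:R * 3 / ln 2 * polylog 1 #|N| * X%:R :> R.
Proof.
move=> leQ; apply: le_trans (_ : (D * ((log_card N).+1 * X))%:R <= _).
  by rewrite ler_nat.
rewrite !natrM !mulrA ler_wpM2r ?ler0n // /polylog expr1 -!mulrA ler_wpM2l ?ler0n //.
rewrite mulrCA mulrC ler_pdivlMr; last by rewrite ln_gt0 // ltr1n.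
exact: log_bound.
Qed.

End Algorithms.

Theorem theorem1p2 (R : realType) :
  (exists (A : R -> forall N : finType, det_algo R N {set N}) (k : nat),
    forall eps : R, 0 < eps ->
    exists C : R,
    forall (N : finType) (f : {set N} -> R) (M : matroid N),
      set_nonneg f -> set_monotone f -> submodular f ->
      [/\ output f M (A eps N) \in indep M,
          (1 - (expR 1)^-1 - eps) * max_indep f M <= f (output f M (A eps N))
        & (queries f M (A eps N))%:R
            <= C * polylog k #|N| * (#|N| * maxn (rank M) 1)%:R])
  /\
  (exists (A : R -> forall N : finType, rand_algo R N {set N}) (k : nat),
    forall eps : R, 0 < eps ->
    exists C : R,
    forall (N : finType) (f : {set N} -> R) (M : matroid N),
      set_nonneg f -> set_monotone f -> submodular f ->
      [/\ forall w : seed (A eps N),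
            output f M (run_seed w) \in indep M,
          (1 - (expR 1)^-1 - eps) * max_indep f M
            <= expected_value f M (A eps N)
        & forall w : seed (A eps N),
            (queries f M (run_seed w))%:R
              <= C * polylog k #|N|
                 * (#|N|%:R + (rank M)%:R * Num.sqrt #|N|%:R)]).
Proof.
split.
- exists det_search, 1%N => eps eps_gt0; set K := rounds 1 eps.
  exists ((1 + 2 * K * @step_cost (colours eps) + 2 * K)%N%:R * 3 / ln 2).
  move=> N f M f0 fm fs; split.
  + apply/basis_indep/(local_search_basis fm fs) => [w S _|w S _]; first exact: subxx.
    exact: leq_trans (max_card _) (leq_log_card N).
  + apply: le_trans (ler_wpM2r (max_indep_ge0 M f0) (ratio_rounds 1 eps_gt0)) _.
    rewrite -(avg_tuple_unit _ (fun t => f (output f M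
      (@local_search R N (colours eps) _ (log_card N) K exhaustive t)))).
    apply: local_search_guarantee => //.
    * by move=> w S _; exact: leq_trans (max_card _) (leq_log_card N).
    * by rewrite card_tuple card_unit exp1n.
    move=> r_gt0; rewrite card_unit; split=> //.
    by apply: exhaustive_progress => //; exact: leq_log_card.
  + exact/polylog_bound/queries_exhaustive/leq_log_card.
- exists rand_search, 1%N => eps eps_gt0; set K := rounds 8 eps.
  exists ((1 + 6 * K * @step_cost (colours eps) + 2 * K)%N%:R * 3 / ln 2).
  move=> N f M f0 fm fs.
  have sub w S : basis M S -> (@sampled N (@isqrt R #|N|) w S).2 \subset S.
    by move=> _; exact: block_sub.
  have exp w S : basis M S -> (#|(@sampled N (@isqrt R #|N|) w S).2| <= 2 ^ log_card N)%N.
    by move=> _; exact: leq_trans (max_card _) (leq_log_card N).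
  split=> [w||w].
  + exact/basis_indep/(local_search_basis fm fs).
  + apply: le_trans (ler_wpM2r (max_indep_ge0 M f0) (ratio_rounds 8 eps_gt0)) _.
    rewrite expected_value_uniform.
    apply: local_search_guarantee => //; first exact: sample_seeds_gt0.
    move=> r_gt0; have n_gt0 : (0 < #|N|)%N := leq_trans r_gt0 (rank_le f M).
    split; first exact: sample_seed_gt0.
    by apply: sampled_progress => //; [exact: isqrt_gt0 | exact: leq_log_card].
  + have := queries_sampled (ell := colours eps) M fm fs K
      (w : (K * #|N|).-tuple (sample_seed N)) (leq_log_card N) (@isqrt_quad R #|N|).
    move=> /(polylog_bound (R := R)) cost; apply: le_trans cost _.
    rewrite ler_wpM2l //; last first.
      by rewrite natrD natrM lerD2l ler_wpM2l // isqrt_le.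
    by rewrite mulr_ge0 ?divr_ge0 ?mulr_ge0 ?ler0n ?ln_ge0 ?ler1n.
Qed.
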